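(* Let $0<p\le 1/2$ and let $\{q_k:k\ge 0\}$ be a non-increasing sequence of non-negative numbers with $q_0>0$. Then the maximal operator $$\widetilde{T}_p^{*}f:=\sup_{n\in\mathbb N_+}\frac{|T_nf|}{(n+1)^{1/p-2}\log^{2[1/2+p]}(n+1)}$$ is bounded from the martingale Hardy space $H_p$ to the space $L_p(G_m)$; that is, there is a constant $c_p$ such that $\|\widetilde{T}_p^{*}f\|_p\le c_p\|f\|_{H_p}$ for all $f\in H_p$.
   Context: $\mathbb N_+$ is the set of positive integers and $\mathbb N=\mathbb N_+\cup\{0\}$. $[x]$ denotes the integer part of $x$. Let $m=(m_0,m_1,\dots)$ be a sequence of integers $m_k\ge 2$ with $\sup_k m_k<\infty$, and let $Z_{m_k}=\{0,\dots,m_k-1\}$ be the additive group of integers modulo $m_k$ with the discrete topology. $G_m=\prod_k Z_{m_k}$ is the (bounded) Vilenkin group with the product topology, and $\mu$ is its Haar measure with $\mu(G_m)=1$ (the product of the uniform measures). Put $M_0=1$, $M_{k+1}=m_kM_k$; every $n\in\mathbb N$ is uniquely $n=\sum_{j\ge0}n_jM_j$ with $n_j\in Z_{m_j}$. For $x\in G_m$ let $I_0(x)=G_m$, $I_n(x)=\{y\in G_m: y_0=x_0,\dots,y_{n-1}=x_{n-1}\}$. Generalized Rademacher functions: $r_k(x)=\exp(2\pi i x_k/m_k)$; Vilenkin system: $\psi_n(x)=\prod_{k\ge 0} r_k(x)^{n_k}$. $\|f\|_p^p=\int_{G_m}|f|^p\,d\mu$. A martingale $f=(f^{(n)},n\in\mathbb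 N)$ is taken with respect to the $\sigma$-algebras $\digamma_n$ generated by $\{I_n(x):x\in G_m\}$; its maximal function is $f^*=\sup_n|f^{(n)}|$, and $H_p$ ($0<p<\infty$) consists of all martingales with $\|f\|_{H_p}:=\|f^*\|_p<\infty$. Vilenkin–Fourier coefficients of a martingale: $\widehat f(i)=\lim_{k\to\infty}\int_{G_m}f^{(k)}\overline{\psi_i}\,d\mu$. Partial sums: $S_nf=\sum_{k=0}^{n-1}\widehat f(k)\psi_k$ (so $S_0f=0$). The $T$ means generated by $\{q_k\}$: $T_nf=\frac1{Q_n}\sum_{k=0}^{n-1}q_kS_kf$ with $Q_n=\sum_{k=0}^{n-1}q_k$, $n\in\mathbb N_+$. *)

(* Defs.v *)
From HB Require Import structures.
From mathcomp Require Import all_boot all_order all_algebra.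
From mathcomp Require Import all_classical all_reals all_analysis.
From mathcomp.real_closed Require Import complex.

Set Implicit Arguments.
Unset Strict Implicit.
Unset Printing Implicit Defensive.

Import Order.TTheory GRing.Theory Num.Theory numFieldNormedType.Exports.

Local Open Scope classical_set_scope.
Local Open Scope ring_scope.

(* ['Z_n] is the integers modulo [n] only for [1 < n]; everything below is
   meant for sequences [m] with [1 < m k] for all [k]. *)
Definition vilenkin (m : nat -> nat) : Type :=
  prod_topology (fun k => discrete_topology 'Z_(m k)).

HB.instance Definition _ m := Topological.on (vilenkin m).

Section vilenkin_group.
Variable m : nat -> nat.
Implicit Types x y z : vilenkin m.

Definition vzero : vilenkin m := fun k => 0 : 'Z_(m k).
Definition vopp x : vilenkin m := fun k => - (x k : 'Z_(m k)).
Definition vadd x y : vilenkin m := fun k => (x k : 'Z_(m k)) + y k.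

Lemma vaddA : associative vadd.
Proof. by move=> x y z; apply: functional_extensionality_dep => k; exact: addrA. Qed.

Lemma vaddC : commutative vadd.
Proof. by move=> x y; apply: functional_extensionality_dep => k; exact: addrC. Qed.

Lemma vadd0 : left_id vzero vadd.
Proof. by move=> x; apply: functional_extensionality_dep => k; exact: add0r. Qed.

Lemma vaddN : left_inverse vzero vopp vadd.
Proof. by move=> x; apply: functional_extensionality_dep => k; exact: addNr. Qed.

HB.instance Definition _ :=
  GRing.isZmodule.Build (vilenkin m) vaddA vaddC vadd0 vaddN.
HB.instance Definition _ := isPointed.Build (vilenkin m) vzero.

HB.instance Definition _ :=
  Measurable.copy (vilenkin m) (g_sigma_algebraType (@open (vilenkin m))).

End vilenkin_group.

(* The normalisation mu(G_m) = 1 is part of [probability]. *)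
Definition is_haar (R : realType) (m : nat -> nat)
    (mu : probability (vilenkin m) R) : Prop :=
  forall (a : vilenkin m) (A : set (vilenkin m)),
    measurable A -> mu [set a + x | x in A] = mu A.

Definition Mprod (m : nat -> nat) (k : nat) : nat := (\prod_(j < k) m j)%N.

Definition digit (m : nat -> nat) (n k : nat) : nat :=
  ((n %/ Mprod m k) %% m k)%N.

Definition cylinder (m : nat -> nat) (n : nat) (x : vilenkin m) :
    set (vilenkin m) :=
  [set y | forall k, (k < n)%N -> y k = x k].

Definition cylinders (m : nat -> nat) (n : nat) : set (set (vilenkin m)) :=
  range (cylinder n).

Definition rademacher (R : realType) (m : nat -> nat) (k : nat)
    (x : vilenkin m) : R[i] :=
  let theta : R := 2 * pi * (nat_of_ord (x k))%:R / (m k)%:R in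
  (cos theta +i* sin theta)%C.

(* Since n < M_n (all m_k >= 2), the digits n_k with k >= n vanish, so the
   infinite product reduces to its first n factors. *)
Definition psi (R : realType) (m : nat -> nat) (n : nat) (x : vilenkin m) :
    R[i] :=
  \prod_(k < n) rademacher R k x ^+ digit m n k.

Section vilenkin_analysis.
Variables (R : realType) (m : nat -> nat) (mu : probability (vilenkin m) R).
Local Notation G := (vilenkin m).

Definition cintegral (A : set G) (g : G -> R[i]) : R[i] :=
  ((\int[mu]_(x in A) complex.Re (g x)) +i*
   (\int[mu]_(x in A) complex.Im (g x)))%C.

Definition cintegrable (g : G -> R[i]) : Prop :=
  mu.-integrable setT (fun x => (complex.Re (g x))%:E) /\
  mu.-integrable setT (fun x => (complex.Im (g x))%:E).

(* The domain carries the sub-sigma-algebra generated by the rank-n cylinders,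
   not the Borel one. *)
Definition adapted (n : nat) (g : G -> R[i]) : Prop :=
  measurable_fun (setT : set (g_sigma_algebraType (@cylinders m n)))
    (fun x => complex.Re (g x)) /\
  measurable_fun (setT : set (g_sigma_algebraType (@cylinders m n)))
    (fun x => complex.Im (g x)).

Definition martingale (f : nat -> G -> R[i]) : Prop :=
  [/\ forall n, adapted n (f n),
      forall n, cintegrable (f n)
    & forall (n k : nat) (A : set G), (n <= k)%N -> <<s @cylinders m n >> A ->
        cintegral A (f k) = cintegral A (f n)].

Definition maximal (f : nat -> G -> R[i]) (x : G) : \bar R :=
  ereal_sup (range (fun n => (Normc.normc (f n x))%:E)).

Definition hardy_norm (p : R) (f : nat -> G -> R[i]) : \bar R :=
  Lnorm mu p%:E (maximal f).

Definition hardy (p : R) (f : nat -> G -> R[i]) : Prop :=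
  martingale f /\ (hardy_norm p f < +oo)%E.

Definition fourier (f : nat -> G -> R[i]) (i : nat) : R[i] :=
  lim ((fun k => cintegral setT (fun x => f k x * (psi R i x)^*) : R[i]^o)
    @ \oo).

Definition partial_sum (f : nat -> G -> R[i]) (n : nat) (x : G) : R[i] :=
  \sum_(k < n) fourier f k * psi R k x.

Definition T_mean (q : nat -> R) (f : nat -> G -> R[i]) (n : nat) (x : G) :
    R[i] :=
  ((\sum_(k < n) q k)^-1)%:C%C * \sum_(k < n) (q k)%:C%C * partial_sum f k x.

Definition weight (p : R) (n : nat) : R :=
  n.+1%:R `^ (p^-1 - 2) * ln n.+1%:R ^ (2 * Num.floor (2^-1 + p)).

Definition maximal_T (p : R) (q : nat -> R) (f : nat -> G -> R[i]) (x : G) :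
    \bar R :=
  ereal_sup [set (Normc.normc (T_mean q f n x) / weight p n)%:E
            | n in [set n : nat | (0 < n)%N]].

End vilenkin_analysis.

(* Main.v *)
Require Import Defs.
From HB Require Import structures.
From mathcomp Require Import all_boot all_order all_algebra.
From mathcomp Require Import all_classical all_reals all_analysis.
From mathcomp.real_closed Require Import complex.
From mathcomp Require Import measurable_realfun ring lra.

Set Implicit Arguments.
Unset Strict Implicit.
Unset Printing Implicit Defensive.

Import Order.TTheory GRing.Theory Num.Theory numFieldNormedType.Exports.

Local Open Scope classical_set_scope.
Local Open Scope ring_scope.

(** By summation by parts [|T_n f|] is at most the maximum of [|F_j f| / j] over
    [1 <= j <= n], where [F_j f] is the sum of the [S_k f] for [k < j]; as the
    weight is nondecreasing, it suffices to treat the Fejer means.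

    For [n < M_N] the kernel of [F_n] is dominated by the sum over
    [t <= A < N] of [M_A M_t] times the indicator of the set of [z] with
    [z_j = 0] for all [j < A], [j <> t].  Hence [|F_n f|] is dominated by sums
    of averages of [|f^(N)|] over neighbourhoods of [x].

    No atomic decomposition is needed: let [u_s] be [|f^(s)|] if this more than
    doubles the last record of the sequence [|f^(0)|, |f^(1)|, ...] and [0]
    otherwise.  Then [u_s] depends on the first [s] coordinates only,
    [|f^(N)| <= 2 (u_0 + ... + u_N)] and, the records being lacunary, the sum of
    the [u_s ^ p] is at most a constant times [(f^* ) ^ p].  Subadditivity of
    [r |-> r ^ p], applied to the sum of [u_s] over the cylinders of level [s],
    where [u_s] is constant, bounds [(|F_n f| / (n w_n)) ^ p] by a sum over
    [s <= N] of terms that do not depend on [n] and whose integrals are at most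
    a constant times that of [u_s ^ p]; this absorbs the supremum over [n]. *)

(** * Mixed radix expansions *)

Section mixed_radix.
Variable m : nat -> nat.
Hypothesis m_ge2 : forall k, (2 <= m k)%N.
Local Notation M := (Mprod m).

Lemma MprodS k : M k.+1 = (M k * m k)%N.
Proof. by rewrite /Mprod big_ord_recr. Qed.

Lemma Mprod0 : M 0 = 1%N.
Proof. by rewrite /Mprod big_ord0. Qed.

Lemma Mprod_gt0 k : (0 < M k)%N.
Proof.
elim: k => [|k ih]; first by rewrite Mprod0.
by rewrite MprodS muln_gt0 ih (leq_trans _ (m_ge2 k)).
Qed.

Lemma leq_exp2_Mprod k : (2 ^ k <= M k)%N.
Proof.
elim: k => [|k ih]; first by rewrite Mprod0.
by rewrite MprodS expnSr leq_mul.
Qed.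

Lemma ltn_Mprod k : (k < M k)%N.
Proof. by rewrite (leq_trans (ltn_expl k _) (leq_exp2_Mprod k)). Qed.

Lemma dvdn_Mprod j k : (j <= k)%N -> (M j %| M k)%N.
Proof.
elim: k => [|k ih]; first by rewrite leqn0 => /eqP ->.
rewrite leq_eqVlt => /predU1P[->//|/ih jk].
by rewrite MprodS dvdn_mulr.
Qed.

Lemma leq_Mprod j k : (j <= k)%N -> (M j <= M k)%N.
Proof. by move=> /dvdn_Mprod; apply: dvdn_leq; exact: Mprod_gt0. Qed.

Lemma digit_small n k : (n < M k)%N -> digit m n k = 0%N.
Proof. by move=> nk; rewrite /digit divn_small// mod0n. Qed.

Lemma digit_lower a j N k : (k < N)%N ->
  digit m (a * M N + j) k = digit m j k.
Proof.
move=> kN; rewrite /digit.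
have /dvdnP[c ->] := dvdn_Mprod kN.
have -> : (a * (c * M k.+1) + j = a * c * m k * M k + j)%N.
  by rewrite MprodS !mulnA mulnAC.
rewrite divnMDl ?Mprod_gt0//.
by rewrite modnMDl.
Qed.

Lemma digit_top a j N : (a < m N)%N -> (j < M N)%N ->
  digit m (a * M N + j) N = a.
Proof.
move=> am jN; rewrite /digit divnMDl ?Mprod_gt0// divn_small// addn0.
exact: modn_small.
Qed.

(** Digits at positions [k] with [n < M k] vanish, so the product may be cut at any level whose [M]
    exceeds [n]. This trades the cut-off [n] in [psi] and [chi] for the level of a cylinder. *)
Lemma prod_digit (C : comNzRingType) (r : nat -> C) n K K' :
  (n < M K)%N -> (n < M K')%N ->
  \prod_(k < K) r k ^+ digit m n k = \prod_(k < K') r k ^+ digit m n k.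
Proof.
wlog KK' : K K' / (K <= K')%N.
  by move=> wl nK nK'; case/orP: (leq_total K K') => ?; [|apply/esym]; apply: wl.
move=> nK _; elim: K' KK' => [|K' ih]; first by rewrite leqn0 => /eqP ->.
rewrite leq_eqVlt => /predU1P[->//|KK']; rewrite big_ord_recr/= -ih//.
by rewrite digit_small ?mulr1// (leq_trans nK)// leq_Mprod.
Qed.

(** [N] is the position of the leading digit of [n]. *)
Lemma Mprod_interval n : (0 < n)%N ->
  exists2 N, (M N <= n)%N & (n < M N.+1)%N.
Proof.
move=> n0; have ex : exists k, (n < M k)%N by exists n; exact: ltn_Mprod.
case: (ex_minnP ex) => -[|k] nk kmin; first by rewrite Mprod0 ltnS leqNgt n0 in nk.
by exists k => //; rewrite leqNgt; apply/negP => /kmin; rewrite ltnn.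
Qed.

End mixed_radix.

(** * Fejer kernels *)

(* Used with [rho k = r_k x * (r_k y)^*], i.e. [rho k = r_k (x - y)], so that
   [chi n = psi_n (x - y)]. *)
Section kernel_bounds.
Variables (C : numDomainType) (m : nat -> nat) (rho : nat -> C) (B : nat).
Hypothesis m_ge2 : forall k, (2 <= m k)%N.
Hypothesis m_le : forall k, (m k <= B)%N.
Hypothesis rho_unity : forall k, rho k ^+ m k = 1.
Hypothesis rho_norm : forall k, `|rho k| = 1.
Local Notation M := (Mprod m).

Definition chi n : C := \prod_(k < n) rho k ^+ digit m n k.
Definition dirichlet n : C := \sum_(i < n) chi i.
(** Not divided by [n]; the sum starts at the zero kernel [dirichlet 0], just as [T_mean] starts at
    the empty partial sum. *)
Definition fejer n : C := \sum_(k < n) dirichlet k.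
Definition geo N a : C := \sum_(c < a) rho N ^+ c.
(** Position [t] is left free. If [t >= A], nothing is freed. *)
Definition near_one A t : bool :=
  [forall j : 'I_A, (j != t :> nat) ==> (rho j == 1)].
Local Notation D := dirichlet.
Local Notation F := fejer.

Lemma sum_ord_mulD (V : nmodType) (f : nat -> V) a N r :
  \sum_(i < a * N + r) f i =
  \sum_(c < a) \sum_(j < N) f (c * N + j)%N + \sum_(j < r) f (a * N + j)%N.
Proof.
have cut n k : \sum_(i < n + k) f i = \sum_(i < n) f i + \sum_(i < k) f (n + i)%N.
  by rewrite big_split_ord/=.
rewrite cut; congr (_ + _); elim: a => [|a ih].
  by rewrite mul0n !big_ord0.
by rewrite mulSnr cut ih big_ord_recr.
Qed.

(** Adding [a * M N] puts the digit [a] at position [N] and leaves the lower digits of [j] alone. *)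
Lemma character_block a j N : (a < m N)%N -> (j < M N)%N ->
  chi (a * M N + j) = rho N ^+ a * chi j.
Proof.
move=> am jN; have lt1 : (a * M N + j < M N.+1)%N.
  rewrite MprodS (@leq_trans (a.+1 * M N))//.
    by rewrite mulSnr ltn_add2l.
  by rewrite mulnC leq_mul2l am orbT.
rewrite /chi (prod_digit m_ge2 rho (ltn_Mprod m_ge2 _) lt1).
rewrite (prod_digit m_ge2 rho (ltn_Mprod m_ge2 j) jN).
rewrite big_ord_recr/= digit_top// mulrC; congr (_ * _).
by apply: eq_bigr => k _; rewrite digit_lower.
Qed.

Lemma Dirichlet_block a j N : (a < m N)%N -> (j <= M N)%N ->
  D (a * M N + j) = geo N a * D (M N) + rho N ^+ a * D j.
Proof.
move=> am jN; rewrite /D sum_ord_mulD; congr (_ + _).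
  rewrite mulr_suml; apply: eq_bigr => c _; rewrite mulr_sumr.
  by apply: eq_bigr => i _; rewrite character_block// (ltn_trans _ am).
rewrite mulr_sumr; apply: eq_bigr => i _.
by rewrite character_block// (leq_trans _ jN).
Qed.

(** A complete sum of powers of an [m N]-th root of unity cancels unless the root is 1. *)
Lemma geo_full N : geo N (m N) = (m N)%:R * (rho N == 1)%:R.
Proof.
rewrite /geo; case: eqP => [->|/eqP r1].
  under eq_bigr do rewrite expr1n.
  by rewrite sumr_const card_ord mulr1.
rewrite mulr0; apply/eqP; have := subrX1 (rho N) (m N).
rewrite rho_unity subrr => /esym/eqP; rewrite mulf_eq0 subr_eq0 (negbTE r1)/=.
by [].
Qed.

(** Paley's formula. Each new level contributes a complete geometric sum, that is, a factor [m N]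
    and the condition [rho N = 1]. *)
Lemma Dirichlet_Mprod N :
  D (M N) = (M N)%:R * [forall j : 'I_N, rho j == 1]%:R.
Proof.
elim: N => [|N ih].
  rewrite /D Mprod0 big_ord1 /chi big_ord0 mul1r.
  by case: forallP => // -[] [].
(* A leading digit stays below [m N], so [M N.+1] is read as [m N - 1] blocks followed by a
   remainder of full length [M N]. *)
have [a mE] : exists a, m N = a.+1 by exists (m N).-1; rewrite prednK// ltnW// m_ge2.
have -> : M N.+1 = (a * M N + M N)%N by rewrite MprodS mE mulnS mulnC addnC.
rewrite Dirichlet_block ?mE// -mulrDl.
have -> : geo N a + rho N ^+ a = geo N (m N) by rewrite mE /geo big_ord_recr.
rewrite geo_full ih mE -mulSnr mulrACA -!natrM; congr (_ * _)%:R.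
rewrite mulnb; congr nat_of_bool; apply/andP/forallP => [[r1 /forallP rj] j|rj].
  case: (unliftP ord_max j) => [i ->|->]//.
  by have := rj i; rewrite /= /bump leqNgt ltn_ord add0n.
split; first exact: (rj ord_max).
by apply/forallP => j; have := rj (widen_ord (leqnSn N) j).
Qed.

Lemma Fejer_block a r N : (a < m N)%N -> (r <= M N)%N ->
  F (a * M N + r) =
  \sum_(c < a) ((M N)%:R * geo N c * D (M N) + rho N ^+ c * F (M N)) +
  (r%:R * geo N a * D (M N) + rho N ^+ a * F r).
Proof.
move=> am rN.
have block b k : (b < m N)%N -> (k <= M N)%N ->
    \sum_(j < k) D (b * M N + j) = k%:R * geo N b * D (M N) + rho N ^+ b * F k.
  move=> bm kN; transitivity (\sum_(j < k) (geo N b * D (M N) + rho N ^+ b * D j)).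
    by apply: eq_bigr => j _; rewrite Dirichlet_block// ltnW// (leq_trans _ kN).
  by rewrite big_split/= sumr_const card_ord -mulr_sumr -mulrA mulr_natl.
rewrite /F sum_ord_mulD block//; congr (_ + _).
by apply: eq_bigr => c _; rewrite block// (ltn_trans _ am).
Qed.

Lemma norm_geo N a : `|geo N a| <= a%:R.
Proof.
rewrite (le_trans (ler_norm_sum _ _ _))//.
under eq_bigr do rewrite normrX rho_norm expr1n.
by rewrite sumr_const card_ord.
Qed.

Lemma near_one_full A t : (A <= t)%N ->
  near_one A t = [forall j : 'I_A, rho j == 1].
Proof.
move=> At; apply: eq_forallb => j.
by rewrite neq_ltn (leq_trans (ltn_ord j) At).
Qed.

(** Induction on the level. The old kernel is multiplied by a complete geometric sum: its terms gain
    the factor [m N] and the condition at position [N]. The Dirichlet part lives where all [rho j]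
    with [j < N] are 1 and supplies the new term [t = N], in which position [N] is free. *)
Lemma norm_Fejer_Mprod A :
  `|F (M A)| <= (B * \sum_(t < A) M t * M A * near_one A t)%:R.
Proof.
elim: A => [|N ih].
  by rewrite /F Mprod0 big_ord1 [D _]big_ord0 normr0.
have [a mE] : exists a, m N = a.+1 by exists (m N).-1; rewrite prednK// ltnW// m_ge2.
have {1}-> : M N.+1 = (a * M N + M N)%N by rewrite MprodS mE mulnS mulnC addnC.
rewrite Fejer_block ?mE//.
have -> : \sum_(c < a) ((M N)%:R * geo N c * D (M N) + rho N ^+ c * F (M N)) +
    ((M N)%:R * geo N a * D (M N) + rho N ^+ a * F (M N)) =
    \sum_(c < m N) ((M N)%:R * geo N c * D (M N) + rho N ^+ c * F (M N)).
  by rewrite mE big_ord_recr.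
rewrite big_split/= -!mulr_suml -/(geo N (m N)) geo_full.
rewrite (le_trans (ler_normD _ _))// big_ord_recr/= mulnDr natrD addrC lerD//.
  rewrite !normrM !normr_nat.
  have h : forall t : 'I_N, near_one N.+1 t = near_one N t && (rho N == 1).
    move=> t; apply/forallP/andP => [rj|[/forallP rj r1] j].
      split; last by have := rj ord_max; rewrite /= gtn_eqF.
      by apply/forallP => j; have := rj (widen_ord (leqnSn N) j).
    case: (unliftP ord_max j) => [i ->|->]; last by rewrite r1 implybT.
    by have := rj i; rewrite /= /bump leqNgt ltn_ord add0n.
  under eq_bigr do rewrite h.
  case: (rho N == 1) => /=; last by rewrite mulr0 mul0r.
  rewrite mulr1 (le_trans (ler_wpM2l _ ih))// -natrM ler_nat.
  rewrite mulnCA leq_mul2l; apply/orP; right; rewrite big_distrr/= leq_sum// => t _.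
  by rewrite andbT MprodS [(m N * _)%N]mulnC -!mulnA leq_mul2l [(near_one _ _ * _)%N]mulnC mulnA leqnn orbT.
have -> : near_one N.+1 N = [forall j : 'I_N, rho j == 1].
  apply/forallP/forallP => rj j.
    by have := rj (widen_ord (leqnSn N) j); rewrite /= ltn_eqF.
  case: (unliftP ord_max j) => [i ->|->]; last by rewrite /= eqxx.
  by have := rj i; rewrite /= /bump leqNgt ltn_ord add0n => ->; rewrite implybT.
rewrite Dirichlet_Mprod.
rewrite normrM normrM !normr_nat.
have gB : `|\sum_(c < m N) (M N)%:R * geo N c| <= (M N * (B * m N))%:R.
  rewrite -mulr_sumr normrM normr_nat natrM ler_wpM2l//.
  rewrite (le_trans (ler_norm_sum _ _ _))// (@le_trans _ _ (\sum_(c < m N) B%:R))//.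
    apply: ler_sum => c _; rewrite (le_trans (norm_geo _ _))// ler_nat.
    by rewrite (leq_trans (ltnW (ltn_ord c))).
  by rewrite sumr_const card_ord -mulrnA.
rewrite (le_trans (ler_wpM2r _ gB))//.
rewrite -!natrM ler_nat MprodS.
set b := nat_of_bool _.
by apply: eq_leq; ring.
Qed.

(** Peeling off the digit at position [N] produces the scale [A = N]: the copies of [F (M N)] give
    the terms [t < N], the Dirichlet parts give [t = N], and the remainder [r < M N] is left to the
    induction. *)
Lemma norm_Fejer n N : (n < M N)%N ->
  `|F n| <= (B ^ 2 * \sum_(A < N) \sum_(t < A.+1) M A * M t * near_one A t)%:R.
Proof.
elim: N n => [|N ih] n.
  rewrite Mprod0 ltnS leqn0 => /eqP ->.
  by rewrite [F _]big_ord0 normr0.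
set a := (n %/ M N)%N; set r := (n %% M N)%N => nN.
have am : (a < m N)%N by rewrite ltn_divLR ?Mprod_gt0// mulnC -MprodS.
have rN : (r < M N)%N by rewrite ltn_mod Mprod_gt0.
have -> : n = (a * M N + r)%N by exact: divn_eq.
rewrite Fejer_block// 1?ltnW// big_ord_recr/= mulnDr natrD.
rewrite big_split/= addrACA addrA.
rewrite (le_trans (ler_normD _ _))// [leRHS]addrC lerD//; last first.
  by rewrite normrM normrX rho_norm expr1n mul1r ih.
rewrite big_ord_recr/= mulnDr natrD (le_trans (ler_normD _ _))// [leRHS]addrC.
have aB : (a <= B)%N by rewrite (leq_trans (ltnW am)).
rewrite lerD//; last first.
  rewrite -mulr_suml normrM (le_trans (ler_pM _ _ (norm_geo _ _) (norm_Fejer_Mprod _)))//.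
  rewrite -natrM ler_nat -mulnA; apply: leq_mul => //.
  by rewrite leq_mul2l; apply/orP; right; apply: leq_sum => t _; rewrite [(M N * _)%N]mulnC.
rewrite Dirichlet_Mprod near_one_full//.
set b := nat_of_bool _.
rewrite -mulr_suml -mulrDl normrM [X in _ * X]ger0_norm ?mulr_ge0//.
have -> : (B ^ 2 * (M N * M N * b))%:R = (M N * B ^ 2)%:R * ((M N)%:R * b%:R) :> C.
  by rewrite !natrM; ring.
rewrite ler_wpM2r// ?mulr_ge0// (le_trans (ler_normD _ _))//.
rewrite -mulr_sumr !normrM !normr_nat.
rewrite (@le_trans _ _ ((M N)%:R * `|\sum_(c < a) geo N c| + (M N)%:R * `|geo N a|))//.
  by rewrite lerD2l ler_wpM2r// ler_nat ltnW.
rewrite -mulrDr natrM ler_wpM2l//.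
rewrite (@le_trans _ _ (\sum_(c < a.+1) B%:R))//.
  rewrite big_ord_recr/= lerD//; last by rewrite (le_trans (norm_geo _ _))// ler_nat.
  rewrite (le_trans (ler_norm_sum _ _ _))// ler_sum// => c _.
  by rewrite (le_trans (norm_geo _ _))// ler_nat (leq_trans (ltnW (ltn_ord c))).
by rewrite sumr_const card_ord -mulrnA ler_nat -mulnn leq_mul// (leq_trans am).
Qed.

End kernel_bounds.

(** * Functions of finitely many coordinates *)

Section cells.
Variable m : nat -> nat.
Local Notation G := (vilenkin m).
Local Notation M := (Mprod m).

(** A finite type that enumerates the cylinders of level [s], so that integrals become finite
    sums. *)
Definition cell s := {dffun forall k : 'I_s, 'Z_(m k)}.

(** Coordinates from [s] on are set to 0. Matching on [idP] provides the proof of [k < s] that the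
    dependent tuple requires. *)
Definition rep s (c : cell s) : G := fun k =>
  match @idP (k < s)%N with
  | ReflectT ks => c (Ordinal ks)
  | ReflectF _ => 0 : 'Z_(m k)
  end.

Definition cell_of s (x : G) : cell s := [ffun k : 'I_s => (x k : 'Z_(m k))].

Lemma repE s (c : cell s) (k : 'I_s) : rep c k = c k.
Proof.
case: k => k ks /=; rewrite /rep; case: {-}_ / idP => // ks'.
by rewrite (bool_irrelevance ks' ks).
Qed.

Lemma cylinder_sym s (x y : G) : cylinder s x y -> cylinder s y x.
Proof. by move=> xy k ks; rewrite xy. Qed.

Lemma cylinder_trans s (y x z : G) :
  cylinder s x y -> cylinder s y z -> cylinder s x z.
Proof. by move=> xy yz k ks; rewrite yz// xy. Qed.

Lemma cylinder_le s s' (x : G) : (s <= s')%N -> cylinder s' x `<=` cylinder s x.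
Proof. by move=> ss' y xy k ks; rewrite xy// (leq_trans ks). Qed.

Lemma cylinder_rep s (x : G) (c : cell s) :
  cylinder s (rep c) x <-> c = cell_of s x.
Proof.
split=> [cx|-> k ks].
  by apply/ffunP => k; rewrite ffunE cx// repE.
by have := repE (cell_of s x) (Ordinal ks); rewrite /= ffunE /= => ->.
Qed.

Lemma cylinder_cell_of s (x : G) : cylinder s (rep (cell_of s x)) x.
Proof. by apply/cylinder_rep. Qed.

Hypothesis m_ge2 : forall k, (2 <= m k)%N.

Lemma card_cell s : #|{: cell s}| = M s.
Proof.
rewrite card_dep_ffun foldrE big_map big_enum/=.
by apply: eq_bigr => k _; rewrite card_ord Zp_cast// m_ge2.
Qed.

(** Prescribing one coordinate is an open condition. The predicate [J] lets the lemma serve both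
    cylinders and sets with one free coordinate. *)
Lemma measurable_coordinates (J : pred nat) s (x : G) :
  measurable [set y : G | forall k, (k < s)%N -> J k -> y k = x k].
Proof.
have -> : [set y : G | forall k, (k < s)%N -> J k -> y k = x k] =
    \bigcap_(k in [set k | (k < s)%N && J k]) [set y : G | y k = x k].
  apply/seteqP; split=> [y xy k /= /andP[ks Jk]|y xy k ks Jk]; first exact: xy.
  by apply: xy; rewrite /= ks.
apply: bigcap_measurableType => k _; apply: sub_sigma_algebra.
have -> : [set y : G | y k = x k] = (proj k) @^-1` [set x k] by [].
apply: open_comp; last exact: discrete_open.
by move=> ? _; exact: proj_continuous.
Qed.

Lemma measurable_cylinder s (x : G) : measurable (cylinder s x).
Proof.
have -> : cylinder s x = [set y : G | forall k, (k < s)%N -> xpredT k -> y k = x k].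
  by apply/seteqP; split=> y xy k ks; [move=> _|]; exact: xy.
exact: measurable_coordinates.
Qed.

(** A pointwise substitute for measurability with respect to the cylinders of level [s]. *)
Definition depends_on (T : Type) s (g : G -> T) : Prop :=
  forall x y, cylinder s x y -> g y = g x.

Lemma depends_on_le T s s' (g : G -> T) :
  (s <= s')%N -> depends_on s g -> depends_on s' g.
Proof. by move=> ss' gs x y /(cylinder_le ss'); exact: gs. Qed.

Lemma depends_on_comp T T' s (g : G -> T) (h : T -> T') :
  depends_on s g -> depends_on s (h \o g).
Proof. by move=> gs x y /gs /= ->. Qed.

Lemma depends_on_rep T s (g : G -> T) x :
  depends_on s g -> g (rep (cell_of s x)) = g x.
Proof. by move=> gs; apply/esym/gs; exact: cylinder_cell_of. Qed.

(** The sets saturated for agreement in the first [s] coordinates form a sigma-algebra that contains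
    the cylinders. *)
Lemma generated_cylinders s (A : set G) : <<s @cylinders m s >> A ->
  forall x y, cylinder s x y -> A x -> A y.
Proof.
move=> sA; pose S : set (set G) :=
  [set A | forall x y, cylinder s x y -> A x -> A y].
have /smallest_sub : sigma_algebra setT S.
  split=> [x y _ //|A' SA x y xy|F SF x y xy [i _ Fix]].
    rewrite setTD /= => nAx Ay; apply: nAx.
    exact: (SA _ _ (cylinder_sym xy)).
  by exists i => //; apply: SF Fix.
move=> /(_ (@cylinders m s)); apply => // _ [z _ <-] x y xy zx.
exact: cylinder_trans zx xy.
Qed.

Lemma sum_indic_cylinder (R : realType) (g : G -> R) s x : depends_on s g ->
  g x = \sum_(c : cell s) g (rep c) * \1_(cylinder s (rep c)) x.
Proof.
move=> gs; rewrite (bigD1 (cell_of s x))//= depends_on_rep// indicE mem_set ?mulr1.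
  rewrite big1 ?addr0// => c cx; rewrite indicE memNset ?mulr0//.
  by move=> /cylinder_rep ce; rewrite ce eqxx in cx.
exact: cylinder_cell_of.
Qed.

Lemma depends_on_measurable (R : realType) s (g : G -> R) :
  depends_on s g -> measurable_fun setT g.
Proof.
move=> gs; rewrite (_ : g = fun x => \sum_(c : cell s)
    g (rep c) * \1_(cylinder s (rep c)) x); last first.
  by apply/funext => x; exact: sum_indic_cylinder.
apply: measurable_sum => c; apply: measurable_funM => //.
by apply: measurable_indic; exact: measurable_cylinder.
Qed.

Variables (R : realType) (mu : probability G R).

Lemma integral_cells s (g : G -> R) D : measurable D -> depends_on s g ->
  (\int[mu]_(x in D) (g x)%:E)%E =
  (\sum_(c : cell s) g (rep c) * fine (mu (D `&` cylinder s (rep c))))%:E.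
Proof.
move=> mD gs.
have mI c : measurable (cylinder s (rep c) : set G) by exact: measurable_cylinder.
have iI (c : cell s) : mu.-integrable D (fun x => (\1_(cylinder s (rep c)) x)%:E).
  by apply: (integrableS measurableT) => //; exact: integrable_indic.
transitivity (\int[mu]_(x in D) (\sum_(c : cell s)
    (g (rep c))%:E * (\1_(cylinder s (rep c)) x)%:E))%E.
  apply: eq_integral => x _; rewrite (sum_indic_cylinder x gs) -sumEFin.
  by apply: eq_bigr => c _; rewrite EFinM.
rewrite integral_sum//; last by move=> c; apply: integrableZl.
rewrite -sumEFin; apply: eq_bigr => c _.
rewrite integralZl// integral_indic// setIC EFinM fineK//.
by rewrite fin_num_measure//; exact: measurableI.
Qed.

Hypothesis mu_haar : is_haar mu.

(** Translation invariance makes the cylinders of level [s] equally large, and the [M s] of them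
    partition a space of measure 1. *)
Lemma mu_cylinder s (x : G) : mu (cylinder s x) = ((M s)%:R^-1)%:E.
Proof.
have mI (y : G) : measurable (cylinder s y : set G) by exact: measurable_cylinder.
have cyl0 (y : G) : mu (cylinder s y) = mu (cylinder s 0).
  rewrite -(mu_haar y (mI 0)); congr (mu _); apply/seteqP; split=> [z yz|z /= [w w0 <-] k ks].
    exists (z - y); last by rewrite addrC subrK.
    move=> k ks; have -> : (z - y) k = (z k : 'Z_(m k)) - y k by [].
    by rewrite yz// subrr.
  by have -> : (y + w) k = (y k : 'Z_(m k)) + w k by []; rewrite w0// addr0.
rewrite cyl0; have := @integral_cells s (cst 1) setT measurableT (fun _ _ _ => erefl).
rewrite (_ : (\int[mu]_x _)%E = 1%:E); last first.
  by rewrite -[RHS](@probability_setT _ _ _ mu) -[RHS]mul1e -integral_cst.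
move=> /(congr1 fine) /=.
under eq_bigr do rewrite setTI cyl0 mul1r.
rewrite sumr_const card_cell => h.
rewrite -(@fineK _ (mu (cylinder s 0))) ?fin_num_measure//; congr _%:E.
have M0 : (M s)%:R != 0 :> R by rewrite pnatr_eq0 -lt0n Mprod_gt0.
by apply: (mulIf M0); rewrite mulVf// mulr_natr -h.
Qed.

End cells.

(** * Partial sums of the Vilenkin-Fourier series *)

Lemma Re_sum (R : rcfType) (I : Type) (r : seq I) (F : I -> R[i]) :
  complex.Re (\sum_(i <- r) F i) = \sum_(i <- r) complex.Re (F i).
Proof. by elim/big_rec2: _ => // i y z _ <-; case: (F i); case: z. Qed.

Lemma Im_sum (R : rcfType) (I : Type) (r : seq I) (F : I -> R[i]) :
  complex.Im (\sum_(i <- r) F i) = \sum_(i <- r) complex.Im (F i).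
Proof. by elim/big_rec2: _ => // i y z _ <-; case: (F i); case: z. Qed.

Lemma normrE (R : rcfType) (z : R[i]) : `|z| = (Normc.normc z)%:C%C.
Proof. by case: z. Qed.

Lemma le_normc (R : rcfType) (z : R[i]) (b : R) :
  `|z| <= b%:C%C -> Normc.normc z <= b.
Proof. by rewrite normrE lecR. Qed.

Lemma normc_sum (R : rcfType) (I : Type) (r : seq I) (F : I -> R[i]) :
  Normc.normc (\sum_(i <- r) F i) <= \sum_(i <- r) Normc.normc (F i).
Proof.
apply: le_normc; rewrite (le_trans (ler_norm_sum _ _ _))// rmorph_sum/=.
by apply: ler_sum => i _; rewrite normrE.
Qed.

Lemma normc_ge0 (R : rcfType) (z : R[i]) : 0 <= Normc.normc z.
Proof. by rewrite -lecR -normrE; exact: normr_ge0. Qed.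

(** * Rademacher functions and the kernels at differences of points *)

Section rademacher.
Variables (R : realType) (m : nat -> nat).
Hypothesis m_ge2 : forall k, (2 <= m k)%N.
Local Notation G := (vilenkin m).

Lemma expr_cos_sin (t : R) n :
  (cos t +i* sin t)%C ^+ n = (cos (t *+ n) +i* sin (t *+ n))%C.
Proof.
elim: n => [|n ih]; first by rewrite expr0 mulr0n cos0 sin0.
rewrite exprS ih mulrS cosD sinD; apply/eqP; rewrite eq_complex/= eqxx/=.
by rewrite addrC.
Qed.

Lemma rademacher_unity k (x : G) : rademacher R k x ^+ m k = 1.
Proof.
have m0 : (m k)%:R != 0 :> R by rewrite pnatr_eq0 -lt0n (leq_trans _ (m_ge2 k)).
rewrite expr_cos_sin.
have -> : 2 * pi * (nat_of_ord (x k))%:R / (m k)%:R *+ m k =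
    0 + pi *+ 2 *+ nat_of_ord (x k) :> R.
  by rewrite add0r -[LHS]mulr_natr mulfVK// mulr_natr mulr_natl.
rewrite (periodicn (@cosD2pi R)) (periodicn (@sinD2pi R)).
by rewrite cos0 sin0.
Qed.

Lemma norm_rademacher k (x : G) : `|rademacher R k x| = 1.
Proof. by rewrite normrE /= cos2Dsin2 sqrtr1. Qed.

(** If [s < t], then [cos (t - s) = 1] forces the sine of the half difference to vanish, although
    that half lies strictly between 0 and [pi]. *)
Lemma cos_sin_inj (s t : R) : 0 <= s < pi *+ 2 -> 0 <= t < pi *+ 2 ->
  cos s = cos t -> sin s = sin t -> s = t.
Proof.
wlog st : s t / s <= t.
  move=> wl s0 t0 cE sE; have /orP[st|ts] := le_total s t; first exact: wl.
  by apply/esym; apply: wl.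
move=> /andP[s0 s2] /andP[t0 t2] cE sE; apply/eqP; rewrite eq_le st/= leNgt.
apply/negP => lt_st.
have : cos (t - s) = 1 by rewrite cosB cE sE -!expr2 cos2Dsin2.
have -> : t - s = (t - s) / 2 *+ 2 by rewrite -mulr_natr mulfVK.
rewrite mulr2n cosD -!expr2 cos2sin2 => h.
have /eqP : sin ((t - s) / 2) ^+ 2 = 0 by lra.
rewrite sqrf_eq0 => /eqP s_eq0.
have := @sin_gt0_pi R ((t - s) / 2); rewrite s_eq0 ltxx.
rewrite -mulr_natr in s2; rewrite -mulr_natr in t2.
suff -> : 0 < (t - s) / 2 < pi by move=> /(_ isT).
by apply/andP; split; lra.
Qed.

Lemma rademacher_inj k (x y : G) :
  rademacher R k x = rademacher R k y -> x k = y k.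
Proof.
have m0 : 0 < (m k)%:R :> R by rewrite ltr0n (leq_trans _ (m_ge2 k)).
have angle (z : G) :
    0 <= 2 * @pi R * (nat_of_ord (z k))%:R / (m k)%:R < @pi R *+ 2.
  rewrite divr_ge0 ?mulr_ge0 ?pi_ge0//= ltr_pdivrMr// -(mulr_natl pi 2).
  rewrite ltr_pM2l ?mulr_gt0 ?pi_gt0// ltr_nat.
  by have := ltn_ord (z k); rewrite [X in (_ < X)%N]Zp_cast// m_ge2.
move=> [cE sE]; have := cos_sin_inj (angle x) (angle y) cE sE.
move=> /(mulIf (invr_neq0 (lt0r_neq0 m0))).
have pi2 : 2 * pi != 0 :> R by rewrite mulf_neq0// lt0r_neq0// pi_gt0.
by move=> /(mulfI pi2) /eqP; rewrite eqr_nat => /eqP /val_inj.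
Qed.

Definition quotient_character (x y : G) (k : nat) : R[i] :=
  rademacher R k x * (rademacher R k y)^*.

Lemma psiM_conj i (x y : G) :
  psi R i x * (psi R i y)^* = chi m (quotient_character x y) i.
Proof.
rewrite /psi rmorph_prod -big_split; apply: eq_bigr => k _.
by rewrite /= rmorphXn/= -exprMn.
Qed.

Lemma psi_depends i N : (i < Mprod m N)%N -> depends_on N (@psi R m i).
Proof.
move=> iN x y xy; have iM := ltn_Mprod m_ge2 i.
have psiN (z : G) : psi R i z = \prod_(k < N) rademacher R k z ^+ digit m i k.
  exact: (prod_digit m_ge2 (fun k => rademacher R k z) iM iN).
rewrite !psiN.
by apply: eq_bigr => k _; rewrite /rademacher xy.
Qed.

(* [nearby A t x y] is the membership of [x - y] in the union of the translates
   of [I_A] along the [t]-th coordinate (and in [I_A] itself when [A <= t]). *)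
Definition nearby A t (x y : G) : bool :=
  [forall j : 'I_A, (j != t :> nat) ==> (x j == y j)].

Lemma nearbyP A t (x y : G) :
  reflect (forall j, (j < A)%N -> j != t -> x j = y j) (nearby A t x y).
Proof.
apply: (iffP forallP) => [xy j jA jt|xy j].
  by have := xy (Ordinal jA); rewrite /= jt => /eqP.
by apply/implyP => jt; apply/eqP; exact: xy.
Qed.

Lemma nearby_sym A t (x y : G) : nearby A t x y = nearby A t y x.
Proof. by apply: eq_forallb => j; rewrite [x j == _]eq_sym. Qed.

Lemma near_one_quotient A t (x y : G) :
  near_one (quotient_character x y) A t -> nearby A t x y.
Proof.
move=> /forallP xy; apply/nearbyP => j jA jt; apply: rademacher_inj.
have := xy (Ordinal jA); rewrite /= jt => /eqP.
move=> /(congr1 (fun z => z * rademacher R j y)); rewrite mul1r => <-.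
rewrite /quotient_character -mulrA [_^* * _]mulrC -normCK norm_rademacher.
by rewrite expr1n mulr1.
Qed.

Lemma norm_fejer_quotient (B : nat) (m_le : forall k, (m k <= B)%N) n N (x y : G) :
  (n < Mprod m N)%N ->
  Normc.normc (fejer m (quotient_character x y) n) <=
  B%:R ^+ 2 * \sum_(A < N) \sum_(t < A.+1)
    (Mprod m A)%:R * (Mprod m t)%:R * (nearby A t x y)%:R.
Proof.
move=> nN.
have rho1 k : quotient_character x y k ^+ m k = 1.
  by rewrite exprMn -rmorphXn !rademacher_unity rmorph1 mulr1.
have rhoN k : `|quotient_character x y k| = 1.
  by rewrite normrM norm_conjC !norm_rademacher mulr1.
apply: le_normc; apply: le_trans (norm_Fejer m_ge2 m_le rho1 rhoN nN) _.
rewrite -[_%:R](rmorph_nat (real_complex R)) lecR natrM natrX ler_wpM2l ?exprn_ge0//.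
rewrite natr_sum ler_sum// => A _; rewrite natr_sum ler_sum// => t _.
rewrite !natrM ler_wpM2l ?mulr_ge0// ler_nat.
case h : (near_one _ _ _) => //.
by rewrite (near_one_quotient h).
Qed.

End rademacher.

(** * Fourier coefficients and Fejer sums of a martingale as finite sums *)

Section partial_sums.
Variables (R : realType) (m : nat -> nat).
Hypothesis m_ge2 : forall k, (2 <= m k)%N.
Variable mu : probability (vilenkin m) R.
Hypothesis mu_haar : is_haar mu.
Local Notation G := (vilenkin m).
Local Notation M := (Mprod m).

(** The preimage of the single value taken at [x] is in the generated sigma-algebra, hence contains
    the whole cylinder of [x]. *)
Lemma adapted_depends_on s (g : G -> R[i]) : adapted s g -> depends_on s g.
Proof.
move=> [mRe mIm] x y xy; apply/eqP; rewrite eq_complex; apply/andP; split; apply/eqP.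
  have := mRe measurableT [set complex.Re (g x)] (measurable_set1 _).
  by rewrite setTI => /generated_cylinders /(_ x y xy erefl).
have := mIm measurableT [set complex.Im (g x)] (measurable_set1 _).
by rewrite setTI => /generated_cylinders /(_ x y xy erefl).
Qed.

Lemma cintegral_cells s (g : G -> R[i]) D : measurable D -> depends_on s g ->
  cintegral mu D g =
  \sum_(c : cell m s) (fine (mu (D `&` cylinder s (rep c))))%:C%C * g (rep c).
Proof.
move=> mD gs; rewrite /cintegral /Rintegral.
rewrite !(integral_cells mu mD (depends_on_comp _ gs))/=.
apply/eqP; rewrite eq_complex Re_sum Im_sum /=; apply/andP; split; apply/eqP.
  by apply: eq_bigr => c _; case: (g _) => a b /=; rewrite mul0r subr0 mulrC.
by apply: eq_bigr => c _; case: (g _) => a b /=; rewrite mul0r addr0 mulrC.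
Qed.

Lemma cintegralT_cells s (g : G -> R[i]) : depends_on s g ->
  cintegral mu setT g = (M s)%:R^-1 * \sum_(c : cell m s) g (rep c).
Proof.
move=> gs; rewrite (cintegral_cells measurableT gs) mulr_sumr; apply: eq_bigr => c _.
by rewrite setTI mu_cylinder//= fmorphV rmorph_nat.
Qed.

Variable f : nat -> G -> R[i].
Hypothesis f_martingale : martingale mu f.

Lemma martingale_depends_on s : depends_on s (f s).
Proof. by case: f_martingale => + _ _; move=> /(_ s)/adapted_depends_on. Qed.

(** As [g] is constant on each cylinder of level [s], the martingale property can be applied
    cylinder by cylinder. *)
Lemma martingale_cintegral s k (g : G -> R[i]) : (s <= k)%N -> depends_on s g ->
  cintegral mu setT (fun x => f k x * g x) =
  cintegral mu setT (fun x => f s x * g x).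
Proof.
move=> sk gs.
have fk := @martingale_depends_on k; have fs := @martingale_depends_on s.
have prod_depends j h : depends_on j (f j) -> depends_on j h ->
    depends_on j (fun x => f j x * h x).
  by move=> fj hj x y xy; rewrite (fj _ _ xy) (hj _ _ xy).
rewrite (cintegralT_cells (prod_depends _ _ fk (depends_on_le sk gs))).
rewrite (cintegralT_cells (prod_depends _ _ fs gs)).
have mI (c : cell m s) : measurable (cylinder s (rep c) : set G).
  exact: measurable_cylinder.
(* The martingale property tested on one cylinder: only the cells [d] of level [k] inside the cell
   [c] contribute. *)
have cellE (c : cell m s) :
    (M k)%:R^-1 * \sum_(d : cell m k | cell_of s (rep d) == c) f k (rep d) =
    (M s)%:R^-1 * f s (rep c).
  case: f_martingale => _ _ /(_ s k _ sk (sub_sigma_algebra _)) mart.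
  have := mart (cylinder s (rep c)) (ex_intro2 _ _ (rep c) I erefl).
  rewrite (cintegral_cells (mI c) fk) (cintegral_cells (mI c) fs).
  rewrite (bigD1 c)//= setIid mu_cylinder//= [X in _ + X]big1 ?addr0.
    rewrite fmorphV rmorph_nat => <-; rewrite mulr_sumr [RHS](bigID (fun d => cell_of s (rep d) == c))/=.
    rewrite [X in _ = _ + X]big1 ?addr0.
      apply: eq_bigr => d /eqP dc.
      have -> : cylinder s (rep c) `&` cylinder k (rep d) = cylinder k (rep d).
        apply: setIidr => y /(cylinder_le sk) dy.
        by apply: cylinder_trans dy; rewrite -dc; exact: cylinder_cell_of.
      by rewrite mu_cylinder//= fmorphV rmorph_nat.
    move=> d /eqP dc.
    have -> : cylinder s (rep c) `&` cylinder k (rep d) = set0.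
      apply/seteqP; split=> // y [cy /(cylinder_le sk) dy]; apply: dc.
      by apply/esym/cylinder_rep; apply: cylinder_trans cy (cylinder_sym dy).
    by rewrite measure0 mul0r.
  move=> d dc.
  have -> : cylinder s (rep c) `&` cylinder s (rep d) = set0.
    apply/seteqP; split=> // y [/cylinder_rep cy /cylinder_rep dy].
    by rewrite cy dy eqxx in dc.
  by rewrite measure0 mul0r.
rewrite (partition_big (fun d : cell m k => cell_of s (rep d)) xpredT)//=.
rewrite !mulr_sumr; apply: eq_bigr => c _.
transitivity ((M k)%:R^-1 *
    \sum_(d : cell m k | cell_of s (rep d) == c) f k (rep d) * g (rep c)).
  congr (_ * _); apply: eq_bigr => d /eqP <-.
  by rewrite depends_on_rep.
by rewrite -mulr_suml mulrA cellE mulrA.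
Qed.

(** Since [psi i] depends on the first [N] coordinates, the sequence defining the coefficient is
    constant from index [N] on. *)
Lemma fourierE i N : (i < M N)%N ->
  fourier mu f i =
  (M N)%:R^-1 * \sum_(c : cell m N) f N (rep c) * (psi R i (rep c))^*.
Proof.
move=> iN; have psi_N : depends_on N (fun x : G => (psi R i x)^*).
  by move=> x y xy; rewrite (psi_depends R m_ge2 iN xy).
rewrite /fourier.
have -> : (M N)%:R^-1 * \sum_(c : cell m N) f N (rep c) * (psi R i (rep c))^* =
    cintegral mu setT (fun x => f N x * (psi R i x)^*).
  rewrite (@cintegralT_cells N (fun x => f N x * (psi R i x)^*))// => x y xy.
  by rewrite (martingale_depends_on xy) (psi_N _ _ xy).
apply: (@lim_near_cst (R[i] : numFieldType)^o); first exact: norm_hausdorff.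
exists N => // k /= Nk; exact: martingale_cintegral.
Qed.

(** Convolution of [f N] with the Fejer kernel, written over the cells of level [N]. *)
Lemma sum_partial_sum n N x : (n <= M N)%N ->
  \sum_(k < n) partial_sum mu f k x =
  (M N)%:R^-1 * \sum_(c : cell m N)
    f N (rep c) * fejer m (quotient_character R x (rep c)) n.
Proof.
move=> nN; rewrite /partial_sum.
transitivity (\sum_(k < n) (M N)%:R^-1 * \sum_(c : cell m N)
    f N (rep c) * dirichlet m (quotient_character R x (rep c)) k).
  apply: eq_bigr => k _.
  under eq_bigr => i _.
    rewrite (@fourierE i N); last first.
      by rewrite (leq_trans (ltn_ord i))// (leq_trans (ltnW (ltn_ord k))).
    rewrite -mulrA mulr_suml; over.
  rewrite -mulr_sumr exchange_big/=; congr (_ * _); apply: eq_bigr => c _.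
  rewrite mulr_sumr; apply: eq_bigr => i _.
  by rewrite -psiM_conj -mulrA [_^* * _]mulrC.
rewrite -mulr_sumr exchange_big/=; congr (_ * _); apply: eq_bigr => c _.
by rewrite -mulr_sumr.
Qed.

Lemma normc_sum_partial_sum (B : nat) (m_le : forall k, (m k <= B)%N) n N x :
  (n < M N)%N ->
  Normc.normc (\sum_(k < n) partial_sum mu f k x) <=
  B%:R ^+ 2 * \sum_(A < N) \sum_(t < A.+1) (M A)%:R * (M t)%:R *
    ((M N)%:R^-1 * \sum_(c : cell m N)
      (nearby A t x (rep c))%:R * Normc.normc (f N (rep c))).
Proof.
move=> nN; rewrite (sum_partial_sum _ (ltnW nN)) Normc.normcM.
have -> : Normc.normc ((M N)%:R^-1 : R[i]) = (M N)%:R^-1.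
  by apply: complexI; rewrite -normrE ger0_norm ?invr_ge0// fmorphV rmorph_nat.
apply: (@le_trans _ _ ((M N)%:R^-1 * \sum_(c : cell m N) Normc.normc (f N (rep c)) *
    (B%:R ^+ 2 * \sum_(A < N) \sum_(t < A.+1)
    (M A)%:R * (M t)%:R * (nearby A t x (rep c))%:R))).
  rewrite ler_wpM2l ?invr_ge0// (le_trans (normc_sum _ _))// ler_sum// => c _.
  by rewrite Normc.normcM ler_wpM2l ?normc_ge0// norm_fejer_quotient.
rewrite le_eqVlt; apply/orP; left; apply/eqP; under eq_bigr do rewrite mulrCA.
rewrite -mulr_sumr mulrCA; congr (_ * _).
under eq_bigr do rewrite mulr_sumr.
rewrite exchange_big mulr_sumr; apply: eq_bigr => A _ /=.
under eq_bigr do rewrite mulr_sumr.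
rewrite exchange_big mulr_sumr; apply: eq_bigr => t _ /=.
rewrite mulrCA; congr (_ * _); rewrite mulr_sumr; apply: eq_bigr => c _.
by rewrite mulrCA [_ * Normc.normc _]mulrC.
Qed.

End partial_sums.

(** * Averages over neighbourhoods *)

Section neighbourhood_sums.
Variables (R : realType) (m : nat -> nat).
Hypothesis m_ge2 : forall k, (2 <= m k)%N.
Variable B : nat.
Hypothesis m_le : forall k, (m k <= B)%N.
Variable mu : probability (vilenkin m) R.
Hypothesis mu_haar : is_haar mu.
Local Notation G := (vilenkin m).
Local Notation M := (Mprod m).

Lemma natM_gt0 k : 0 < (M k)%:R :> R.
Proof. by rewrite ltr0n Mprod_gt0. Qed.

Lemma measurable_nearby A t (x : G) : measurable [set y : G | nearby A t x y].
Proof.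
have -> : [set y : G | nearby A t x y] =
    [set y : G | forall j, (j < A)%N -> j != t -> y j = x j].
  apply/seteqP; split=> y /=.
    by move=> /nearbyP xy j jA jt; rewrite xy.
  by move=> xy; apply/nearbyP => j jA jt; rewrite xy.
exact: (measurable_coordinates (fun j => j != t)).
Qed.

(* For [t < A] the set is the union of the [m_t <= B] cylinders obtained by
   freeing the coordinate [t]. *)
Lemma mu_nearby_le A t (x : G) :
  fine (mu [set y : G | nearby A t x y]) <= B%:R / (M A)%:R.
Proof.
have mN := measurable_nearby A t x.
(* The point [x] with coordinate [t] replaced by [a]; the values [a < B] exhaust the possible
   coordinates. *)
have z_ (a : nat) : {z : G | forall j, z j = if j == t then a%:R else x j :> 'Z_(m j)}.
  by exists (fun j => if j == t then a%:R else x j : 'Z_(m j)).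
pose F a : set G := cylinder A (sval (z_ a)).
have mF a : measurable (F a) by exact: measurable_cylinder.
rewrite -lee_fin fineK; last exact: fin_num_measure.
apply: (@le_trans _ _ (mu (\big[setU/set0]_(a < B) F a))).
  apply: le_measure; rewrite ?inE//; first exact: bigsetU_measurable.
  move=> y /= /nearbyP xy; rewrite -bigcup_mkord.
  have yB : (nat_of_ord (y t) < B)%N.
    rewrite (leq_trans (ltn_ord _))//.
    by rewrite (leq_trans _ (m_le t))// Zp_cast// m_ge2.
  exists (nat_of_ord (y t)) => //= j jA; rewrite (svalP (z_ _)).
  case: eqP => [->|/eqP jt]; last by rewrite xy.
  by rewrite natr_Zp.
rewrite (le_trans (Boole_inequality _ _))//.
rewrite (eq_bigr (fun=> ((M A)%:R^-1)%:E)); last first.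
  by move=> a _; exact: mu_cylinder.
by rewrite sumEFin lee_fin sumr_const card_ord mulr_natl.
Qed.

(** Divided by [M s], this is the integral of [v] over the neighbourhood of order [(A, t)] when
    [A <= s] and [v] depends on [s] coordinates. *)
Definition nearby_sum s A t (v : G -> R) (x : G) : R :=
  \sum_(c : cell m s) (nearby A t x (rep c))%:R * v (rep c).

Lemma nearby_sum_ge0 s A t v x : (forall y, 0 <= v y) -> 0 <= nearby_sum s A t v x.
Proof. by move=> v0; apply: sumr_ge0 => c _; rewrite mulr_ge0. Qed.

Lemma nearby_cylinder A t s (x y z : G) : (A <= s)%N -> cylinder s y z ->
  nearby A t x z = nearby A t x y.
Proof.
move=> As yz; apply: eq_forallb => j.
by rewrite yz// (leq_trans (ltn_ord j)).
Qed.

Lemma nearby_sum_depends s A t v : (A <= s)%N -> depends_on s (nearby_sum s A t v).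
Proof.
move=> As x y xy; apply: eq_bigr => c _.
by rewrite nearby_sym (nearby_cylinder _ _ As xy) nearby_sym.
Qed.

Lemma integral_nearby s A t v x : (A <= s)%N -> depends_on s v ->
  (\int[mu]_(y in [set y | nearby A t x y]) (v y)%:E)%E =
  ((M s)%:R^-1 * nearby_sum s A t v x)%:E.
Proof.
move=> As vs; rewrite (integral_cells mu (measurable_nearby _ _ _) vs).
rewrite mulr_sumr; congr _%:E; apply: eq_bigr => c _.
case: (boolP (nearby A t x (rep c))) => [xc|xc].
  rewrite (_ : _ `&` _ = cylinder s (rep c)) ?mu_cylinder//=.
    by rewrite mul1r mulrC.
  apply: setIidr => y cy /=; by rewrite (nearby_cylinder _ _ As cy).
rewrite (_ : _ `&` _ = set0) ?measure0/= ?mulr0 ?mul0r ?mulr0//.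
apply/seteqP; split=> // y [/= xy cy].
by rewrite -(nearby_cylinder _ _ As cy) xy in xc.
Qed.

(** A level-[s] cylinder meeting the neighbourhood is near [x] in the coordinates below [minn A s],
    and the intersection has measure at most [B / M (maxn A s)]: the cylinder bounds it if [A <= s],
    the neighbourhood if [s < A]. With [minn t s], a free coordinate [t >= s] exempts nothing below
    [s]. *)
Lemma nearby_sum_coarsen s N A t v x : (s <= N)%N -> (A <= N)%N ->
  depends_on s v -> (forall y, 0 <= v y) ->
  (M N)%:R^-1 * nearby_sum N A t v x <=
  B%:R / (M (maxn A s))%:R * nearby_sum s (minn A s) (minn t s) v x.
Proof.
move=> sN AN vs v0.
have /(congr1 fine)/= <- := integral_nearby t x AN (depends_on_le sN vs).
rewrite (integral_cells mu (measurable_nearby _ _ _) vs)/=.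
rewrite mulr_sumr; apply: ler_sum => c _; rewrite mulrC mulrA ler_wpM2r//.
case: (boolP (nearby (minn A s) _ x (rep c))) => [xc|xc].
  rewrite mulr1; have mN := measurable_nearby A t x.
  have mC : measurable (cylinder s (rep c) : set G) by exact: measurable_cylinder.
  have [As|sA] := leqP A s.
    have /fine_le : (mu ([set y | nearby A t x y] `&` cylinder s (rep c)) <=
        mu (cylinder s (rep c)))%E.
      by apply: le_measure; rewrite ?inE//; exact: measurableI.
    rewrite !fin_num_measure//; last exact: measurableI.
    move=> /(_ isT isT) /le_trans; apply; rewrite mu_cylinder//=.
    rewrite ler_peMl ?invr_ge0// ler1n.
    by rewrite (leq_trans _ (m_le 0))// ltnW// m_ge2.
  apply: le_trans (mu_nearby_le A t x).
  apply: fine_le; rewrite ?fin_num_measure//; first exact: measurableI.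
  by apply: le_measure; rewrite ?inE//; exact: measurableI.
rewrite (_ : _ `&` _ = set0) ?measure0/= ?mulr0//.
apply/seteqP; split=> // y [/= /nearbyP xy cy].
move/negP: xc; apply; apply/nearbyP => j; rewrite leq_min => /andP[jA js] jt.
rewrite xy// ?cy//; apply: contra_neq jt => jt.
by rewrite -jt; apply/esym/minn_idPl/ltnW.
Qed.

(** After exchanging the sums, each cell is counted once for every cell near it; that number is
    [M s] times the measure of a neighbourhood. *)
Lemma sum_nearby_sum s A t v : (A <= s)%N -> (forall y, 0 <= v y) ->
  \sum_(d : cell m s) nearby_sum s A t v (rep d) <=
  B%:R * (M s)%:R / (M A)%:R * \sum_(c : cell m s) v (rep c).
Proof.
move=> As v0; rewrite /nearby_sum exchange_big mulr_sumr.
apply: ler_sum => c _ /=; rewrite -mulr_suml ler_wpM2r//.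
have := @integral_nearby s A t (cst 1) (rep c) As (fun _ _ _ => erefl).
have -> : (\int[mu]_(y in [set y | nearby A t (rep c) y]) (cst 1 y)%:E)%E =
    mu [set y | nearby A t (rep c) y].
  rewrite -[RHS]mul1e -integral_cst//; exact: measurable_nearby.
move=> /(congr1 fine)/= h; have := mu_nearby_le A t (rep c).
rewrite {}h ler_pdivrMl ?natM_gt0// mulrCA mulrA; apply: le_trans.
rewrite le_eqVlt; apply/orP; left; apply/eqP.
by apply: eq_bigr => d _; rewrite mulr1 nearby_sym.
Qed.

End neighbourhood_sums.

(** * Lacunary power sums *)

Section power_sums.
Variables (R : realType) (p : R).
Hypothesis p_gt0 : 0 < p.

(** For two summands with total [T], each ratio [b / T] lies in the unit interval and is thus at
    most its [p]-th power. *)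
Lemma powR_sum_le (I : Type) (r : seq I) (a : I -> R) : p <= 1 ->
  (forall i, 0 <= a i) ->
  (\sum_(i <- r) a i) `^ p <= \sum_(i <- r) a i `^ p.
Proof.
move=> p_le1 a0; elim: r => [|i r ih]; first by rewrite !big_nil powR0// gt_eqF.
rewrite !big_cons; set S := \sum_(j <- r) a j in ih *.
have S0 : 0 <= S by apply: sumr_ge0.
apply: le_trans (lerD (lexx _) ih).
have := addr_ge0 (a0 i) S0; rewrite le_eqVlt => /predU1P[<-|T0].
  by rewrite powR0 ?gt_eqF// addr_ge0 ?powR_ge0.
have part b : 0 <= b -> b <= a i + S ->
    b / (a i + S) * (a i + S) `^ p <= b `^ p.
  rewrite le_eqVlt => /predU1P[<-|b0] bT; first by rewrite !mul0r powR_ge0.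
  have -> : b `^ p = (b / (a i + S)) `^ p * (a i + S) `^ p.
    by rewrite -powRM ?ltW ?divr_gt0// divfK// lt0r_neq0.
  rewrite ler_wpM2r ?powR_ge0// ger1_powR// divr_gt0//=.
  by rewrite ler_pdivrMr// mul1r.
apply: le_trans (lerD (part _ (a0 i) _) (part _ S0 _)); rewrite ?lerDl ?lerDr//.
by rewrite -mulrDl -mulrDl divff ?mul1r// gt_eqF.
Qed.

(** The sum of the geometric series of ratio [2 ^ (- p)]. *)
Definition geom_const : R := (1 - 2 `^ (- p))^-1.

Lemma powR2N_lt1 : 2 `^ (- p) < 1 :> R.
Proof.
rewrite powRN invf_lt1 ?powR_gt0// -[ltLHS](congr1 (@^~ p) (@powR1 R)).
by rewrite gt0_ltr_powR ?nnegrE// ltr1n.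
Qed.

Lemma geom_const_gt0 : 0 < geom_const.
Proof. by rewrite invr_gt0 subr_gt0 powR2N_lt1. Qed.

Lemma geom_constE : geom_const * 2 `^ (- p) + 1 = geom_const.
Proof.
have h : 1 - 2 `^ (- p) != 0 :> R by rewrite gt_eqF// subr_gt0 powR2N_lt1.
by rewrite /geom_const; field.
Qed.

Lemma geom_const_ge1 : 1 <= geom_const.
Proof. by rewrite -geom_constE lerDr mulr_ge0 ?powR_ge0// ltW ?geom_const_gt0. Qed.

(** The induction step for sums of [p]-th powers of a sequence that at least doubles: such a sum
    stays below [geom_const] times its last term. *)
Lemma geom_step (a b : R) : 0 <= a -> 2 * a <= b ->
  geom_const * a `^ p + b `^ p <= geom_const * b `^ p.
Proof.
move=> a0 ab; rewrite -[in leRHS]geom_constE mulrDl mul1r lerD2r -mulrA.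
rewrite ler_wpM2l ?(ltW geom_const_gt0)// powRN mulrC ler_pdivlMr ?powR_gt0//.
rewrite -powRM// ge0_ler_powR ?nnegrE ?mulr_ge0 ?(ltW p_gt0)//.
  by rewrite (le_trans _ ab)// mulr_ge0.
by rewrite mulrC.
Qed.

Section records.
Variable a : nat -> R.
Hypothesis a_ge0 : forall s, 0 <= a s.

Fixpoint last_record s : R :=
  if s is s'.+1 then
    if 2 * last_record s' < a s then a s else last_record s'
  else a 0%N.

(** The initial term always counts as a record; 0 marks an index without a new one. *)
Definition new_record s : R :=
  if s is s'.+1 then if 2 * last_record s' < a s then a s else 0 else a 0%N.

Lemma last_record_ex s : exists2 k, (k <= s)%N & last_record s = a k.
Proof.
elim: s => [|s [k ks ih]] /=; first by exists 0%N.
by case: ifPn => _; [exists s.+1|exists k => //; exact: ltnW].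
Qed.

Lemma last_record_ge0 s : 0 <= last_record s.
Proof. by have [k _ ->] := last_record_ex s. Qed.

Lemma new_record_ge0 s : 0 <= new_record s.
Proof. by case: s => [|s] //=; case: ifPn. Qed.

Lemma le_last_record s : a s <= 2 * last_record s.
Proof.
case: s => [|s] /=; first by rewrite ler_peMl// ler1n.
by case: ltP => //; rewrite ler_peMl// ler1n.
Qed.

Lemma last_record_le_sum s : last_record s <= \sum_(k < s.+1) new_record k.
Proof.
elim: s => [|s ih]; first by rewrite big_ord1.
rewrite big_ord_recr /=; case: ifPn => _; last by rewrite addr0.
by rewrite lerDr sumr_ge0// => k _; exact: new_record_ge0.
Qed.

(* Records at least double, so their [p]-th powers form a lacunary sum. *)
Lemma sum_new_record_le s :
  \sum_(k < s.+1) new_record k `^ p <= geom_const * last_record s `^ p.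
Proof.
elim: s => [|s ih].
  by rewrite big_ord1/= ler_peMl ?powR_ge0// geom_const_ge1.
rewrite big_ord_recr /=; case: ifPn => [lt|_].
  rewrite (le_trans (lerD ih (lexx _)))// geom_step ?last_record_ge0//.
  exact: ltW.
by rewrite powR0 ?gt_eqF// addr0.
Qed.

Lemma le_sum_new_record s : a s <= 2 * \sum_(k < s.+1) new_record k.
Proof.
by rewrite (le_trans (le_last_record s))// ler_wpM2l// last_record_le_sum.
Qed.

End records.

Lemma eq_last_record (a b : nat -> R) s :
  (forall k, (k <= s)%N -> a k = b k) -> last_record a s = last_record b s.
Proof.
elim: s => [|s ih] ab /=; first exact: ab.
by rewrite ih ?ab// => k ks; apply: ab; exact: leqW.
Qed.

Lemma eq_new_record (a b : nat -> R) s :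
  (forall k, (k <= s)%N -> a k = b k) -> new_record a s = new_record b s.
Proof.
case: s => [|s] ab /=; first exact: ab.
by rewrite (@eq_last_record a b s) ?ab// => k ks; apply: ab; exact: leqW.
Qed.

End power_sums.

(** * Weighted sums over the scales of the kernel bound *)

Section weighted_sums.
Variables (R : realType) (m : nat -> nat) (p : R).
Hypothesis m_ge2 : forall k, (2 <= m k)%N.
Hypothesis p_gt0 : 0 < p.
Hypothesis p_le : p <= 2^-1.
Local Notation M := (Mprod m).
Local Notation C := (geom_const p).

Definition Mpow (r : R) k : R := (M k)%:R `^ r.

Lemma Mpow_gt0 r k : 0 < Mpow r k.
Proof. by rewrite powR_gt0// ltr0n Mprod_gt0. Qed.

Lemma Mpow_ge0 r k : 0 <= Mpow r k.
Proof. exact: powR_ge0. Qed.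

Lemma MpowD r s k : Mpow (r + s) k = Mpow r k * Mpow s k.
Proof. by rewrite /Mpow powRD//; apply/implyP => _; rewrite pnatr_eq0 -lt0n Mprod_gt0. Qed.

Lemma MpowN r k : Mpow (- r) k = (Mpow r k)^-1.
Proof. exact: powRN. Qed.

Lemma Mpow1 k : Mpow 1 k = (M k)%:R.
Proof. by rewrite /Mpow powRr1. Qed.

Lemma Mpow_le r j k : 0 <= r -> (j <= k)%N -> Mpow r j <= Mpow r k.
Proof.
by move=> r0 jk; rewrite ge0_ler_powR ?nnegrE// ler_nat leq_Mprod.
Qed.

Lemma Mpow_ge r j k : r <= 0 -> (j <= k)%N -> Mpow r k <= Mpow r j.
Proof.
move=> r0 jk; rewrite -[r]opprK ![Mpow (- - r) _]MpowN.
by rewrite lef_pV2 ?posrE ?Mpow_gt0// Mpow_le// oppr_ge0.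
Qed.

Lemma sum_Mpow_le A : \sum_(t < A.+1) Mpow p t <= C * Mpow p A.
Proof.
elim: A => [|A ih].
  by rewrite big_ord1 ler_peMl ?Mpow_ge0// geom_const_ge1.
rewrite big_ord_recr/= (le_trans (lerD ih (lexx _)))// geom_step//.
by rewrite -natrM ler_nat MprodS mulnC leq_mul2l m_ge2 orbT.
Qed.

(* Bounded when [p < 1/2] and equal to [N + 1] when [p = 1/2], as is the [p]-th
   power of the logarithm in [weight] at [n ~ M_N], up to constants. *)
Definition log_factor N : R := \sum_(A < N.+1) Mpow (2 * p - 1) A.

Lemma log_factor_gt0 N : 0 < log_factor N.
Proof.
rewrite /log_factor big_ord_recr/= ltr_wpDl ?Mpow_gt0// sumr_ge0// => A _.
exact: Mpow_ge0.
Qed.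

Lemma log_factor_le s N : (s <= N)%N -> log_factor s <= log_factor N.
Proof.
move=> /subnK <-; elim: (N - s)%N => [|k ih]; first by rewrite add0n.
by rewrite (le_trans ih)// addSn /log_factor [leRHS]big_ord_recr/= lerDl Mpow_ge0.
Qed.

(** The exponent [2 * p - 1] is at most 0, so the terms of [log_factor] decrease. *)
Lemma log_factor_ge N : N%:R * Mpow (2 * p - 1) N <= log_factor N.
Proof.
rewrite mulr_natl /log_factor big_ord_recr/= -[leLHS]addr0 lerD ?Mpow_ge0//.
rewrite (_ : _ *+ N = \sum_(A < N) Mpow (2 * p - 1) N) ; last first.
  by rewrite sumr_const card_ord.
rewrite ler_sum// => A _.
by rewrite Mpow_ge ?(ltnW (ltn_ord A))//; have := p_le; lra.
Qed.

(* The majorant of the contribution of the martingale records of level [s],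
   with [q A t] standing for the sum of their [p]-th powers over the
   neighbourhood of order [(A, t)]. *)
Definition level_sum s (q : nat -> nat -> R) : R :=
  (log_factor s)^-1 * Mpow (-1) s *
    (\sum_(A < s.+1) \sum_(t < A.+1) Mpow p A * Mpow p t * q A t) +
  C * \sum_(t < s.+1) Mpow (- p) s * Mpow p t * q s t.

Lemma level_sum_ge0 s q : (forall A t, 0 <= q A t) -> 0 <= level_sum s q.
Proof.
move=> q0; rewrite addr_ge0// ?mulr_ge0 ?invr_ge0 ?Mpow_ge0//.
- exact/ltW/log_factor_gt0.
- apply: sumr_ge0 => A _; apply: sumr_ge0 => t _.
  by rewrite !mulr_ge0 ?Mpow_ge0.
- by rewrite subr_ge0 ltW// powR2N_lt1.
- by apply: sumr_ge0 => t _; rewrite !mulr_ge0 ?Mpow_ge0.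
Qed.

(** For scales finer than [s]. The indices [t >= s] all share the value [q s s] and their weights
    sum to at most [C * Mpow p A]; for [t < s] the factor [Mpow p N * Mpow (- p) s] is at least
    1. *)
Lemma sum_fine_scales_le s N A (q : nat -> nat -> R) :
  (forall A t, 0 <= q A t) -> (s <= A)%N -> (A <= N)%N ->
  \sum_(t < A.+1) Mpow p t * q s (minn t s) <=
  Mpow p N * (C * \sum_(t < s.+1) Mpow (- p) s * Mpow p t * q s t).
Proof.
move=> q0 sA AN.
have q0' t : 0 <= Mpow (- p) s * Mpow p t * q s t by rewrite !mulr_ge0 ?Mpow_ge0.
have C1 := geom_const_ge1 p_gt0.
have C0 : 0 <= C by rewrite (le_trans _ C1).
have pE k : Mpow p k * Mpow (- p) k = 1.
  by rewrite MpowN divff// gt_eqF// Mpow_gt0.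
rewrite [X in _ <= _ * (_ * X)]big_ord_recr/= !mulrDr.
have -> : A.+1 = (s + (A.+1 - s))%N by rewrite subnKC// leqW.
rewrite big_split_ord/= lerD//.
  rewrite mulrCA (@le_trans _ _ (Mpow p N * \sum_(t < s) Mpow (- p) s * Mpow p t * q s t))//.
    rewrite mulr_sumr ler_sum// => t _.
    rewrite (minn_idPl _) ?(ltnW (ltn_ord t))// mulrA ler_wpM2r// mulrA.
    by rewrite ler_peMl ?Mpow_ge0// -(pE s) ler_wpM2r ?Mpow_ge0// Mpow_le ?ltW// (leq_trans sA).
  by rewrite ler_peMl// mulr_ge0 ?Mpow_ge0// sumr_ge0.
rewrite (_ : Mpow p N * _ = Mpow p N * C * q s s); last first.
  by rewrite [Mpow (- p) s * _]mulrC pE mul1r mulrA.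
under eq_bigr do rewrite (minn_idPr (leq_addr _ _)).
rewrite -mulr_suml ler_wpM2r// mulrC.
rewrite (@le_trans _ _ (C * Mpow p A))//; last by rewrite ler_wpM2l// Mpow_le// ltW.
apply: le_trans (sum_Mpow_le A).
have -> : \sum_(t < A.+1) Mpow p t = \sum_(t < s + (A.+1 - s)) Mpow p t.
  by rewrite subnKC// leqW.
by rewrite big_split_ord/= lerDr sumr_ge0// => t _; exact: Mpow_ge0.
Qed.

(** The bound is free of [N], which is what absorbs the supremum. For [A <= s] the prefactor
    decreases in [N], so it may be taken at [s]. The finer scales give at most [N] copies of one
    quantity, and [log_factor_ge] pays for the factor [N]. *)
Lemma scale_sum_le s N (q : nat -> nat -> R) :
  (forall A t, 0 <= q A t) -> (s <= N)%N ->
  Mpow (p - 1) N / log_factor N *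
    (\sum_(A < N) \sum_(t < A.+1) Mpow p A * Mpow p t * Mpow (- p) (maxn A s) *
      q (minn A s) (minn t s)) <= level_sum s q.
Proof.
move=> q0 sN.
set Z := C * \sum_(t < s.+1) Mpow (- p) s * Mpow p t * q s t.
have Z0 : 0 <= Z.
  rewrite mulr_ge0 ?sumr_ge0//; first exact: ltW (geom_const_gt0 p_gt0).
  by move=> t _; rewrite !mulr_ge0 ?Mpow_ge0.
have MZ0 : 0 <= Mpow p N * Z by rewrite mulr_ge0 ?Mpow_ge0.
pose X A := \sum_(t < A.+1) Mpow p A * Mpow p t * q A t.
have X0 A : 0 <= X A by apply: sumr_ge0 => t _; rewrite !mulr_ge0 ?Mpow_ge0.
have L0 k : 0 < log_factor k := log_factor_gt0 k.
have step A : (A < N)%N -> \sum_(t < A.+1) Mpow p A * Mpow p t *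
      Mpow (- p) (maxn A s) * q (minn A s) (minn t s) <=
    (A <= s)%:R * (Mpow (- p) s * X A) + Mpow p N * Z.
  move=> AN; have [As|sA] := leqP A s.
    rewrite mul1r -[leLHS]addr0 lerD// /X mulr_sumr.
    rewrite le_eqVlt; apply/orP; left; apply/eqP; apply: eq_bigr => t _.
    have -> : minn t s = t by apply/minn_idPl; rewrite (leq_trans _ As)// -ltnS.
    by ring.
  rewrite mul0r add0r; apply: le_trans (sum_fine_scales_le q0 (ltnW sA) (ltnW AN)).
  rewrite ler_sum// => t _; rewrite [Mpow p A * _]mulrC -[_ * _ * Mpow (- p) A]mulrA.
  by rewrite MpowN divff ?mulr1// gt_eqF// Mpow_gt0.
rewrite (@le_trans _ _ (Mpow (p - 1) N / log_factor N *
    (\sum_(A < N) ((A <= s)%:R * (Mpow (- p) s * X A) + Mpow p N * Z))))//.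
  rewrite ler_wpM2l ?divr_ge0 ?Mpow_ge0// ?(ltW (L0 _))//.
  by apply: ler_sum => A _; exact: step.
rewrite big_split/= mulrDr sumr_const card_ord /level_sum -/Z lerD//.
  have XE : \sum_(A < N) (A <= s)%:R * (Mpow (- p) s * X A) <=
      Mpow (- p) s * \sum_(A < s.+1) X A.
    rewrite mulr_sumr; have [Ns|sN'] := leqP N s.+1.
      rewrite -(subnKC Ns) big_split_ord/= -[leLHS]addr0 lerD//; last first.
        by apply: sumr_ge0 => A _; rewrite mulr_ge0 ?Mpow_ge0.
      rewrite ler_sum// => A _; rewrite ler_piMl ?mulr_ge0 ?Mpow_ge0//.
      by rewrite lern1 leq_b1.
    rewrite -(subnKC (ltnW sN')) big_split_ord/= -[leRHS]addr0 lerD//.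
      rewrite ler_sum// => A _; rewrite ler_piMl ?mulr_ge0 ?Mpow_ge0//.
      by rewrite lern1 leq_b1.
    rewrite big1// => A _.
    by rewrite leqNgt ltnS leq_addr mul0r.
  rewrite (le_trans (ler_wpM2l _ XE))//.
    by rewrite divr_ge0 ?Mpow_ge0// ltW.
  rewrite mulrA ler_wpM2r ?sumr_ge0// mulrC.
  have -> : Mpow (-1) s = Mpow (- p) s * Mpow (p - 1) s by rewrite -MpowD; congr Mpow; lra.
  rewrite [leRHS]mulrC -mulrA ler_wpM2l ?Mpow_ge0// ler_pM ?Mpow_ge0//.
  - by rewrite invr_ge0 ltW.
  - by rewrite Mpow_ge//; have := p_le; lra.
  - by rewrite lef_pV2 ?posrE// log_factor_le.
rewrite -(mulr_natl _ N) (_ : _ * _ =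
    N%:R * (Mpow (p - 1) N * Mpow p N) / log_factor N * Z); last by ring.
rewrite -MpowD ler_piMl// ler_pdivrMr// mul1r.
rewrite (_ : p - 1 + p = 2 * p - 1); last by ring.
exact: log_factor_ge.
Qed.

(** Summing over [t] costs a factor [C]. In the first part of [level_sum] the remaining sum over [A]
    is exactly [log_factor s], which cancels. *)
Lemma sum_level_const s (B K : R) (q : nat -> nat -> R) : 0 <= K -> 0 <= B ->
  (forall A t, (A <= s)%N -> q A t <= B * (M s)%:R / (M A)%:R * K) ->
  level_sum s q <= B * (C + C ^+ 2) * K.
Proof.
move=> K0 B0 qK; rewrite mulrDr mulrDl lerD//.
- have L0 := log_factor_gt0 s.
  rewrite -mulrA ler_pdivrMl// [Mpow (-1) s * _]mulrC [log_factor s * _]mulrC.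
  apply: (@le_trans _ _ ((\sum_(A < s.+1) \sum_(t < A.+1)
      Mpow p A * Mpow p t * (B * (M s)%:R / (M A)%:R * K)) * Mpow (-1) s)).
    rewrite ler_wpM2r ?Mpow_ge0// ler_sum// => A _; rewrite ler_sum// => t _.
    by rewrite ler_wpM2l ?mulr_ge0 ?Mpow_ge0// qK// -ltnS.
  rewrite (_ : B * C * K * log_factor s = \sum_(A < s.+1)
    (B * K * (C * Mpow p A) * (Mpow p A * Mpow (-1) A))); last first.
    rewrite /log_factor mulr_sumr; apply: eq_bigr => A _.
    rewrite (_ : 2 * p - 1 = p + p + -1) ?MpowD; [ring|lra].
  rewrite mulr_suml ler_sum// => A _.
  rewrite -mulr_suml -mulr_sumr.
  have Ms0 : (M s)%:R != 0 :> R by rewrite pnatr_eq0 -lt0n Mprod_gt0.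
  have MA0 : (M A)%:R != 0 :> R by rewrite pnatr_eq0 -lt0n Mprod_gt0.
  rewrite ![Mpow (-1) _]MpowN !Mpow1.
  rewrite (_ : _ * _ / (M s)%:R = B * K * (\sum_(i < A.+1) Mpow p i) *
    (Mpow p A / (M A)%:R)); last by field; rewrite Ms0 MA0.
  by rewrite ler_wpM2r ?divr_ge0 ?Mpow_ge0// ler_wpM2l ?mulr_ge0// sum_Mpow_le.
- have C0 := ltW (geom_const_gt0 p_gt0).
  rewrite expr2 (_ : B * (C * C) * K = C * (B * K * C)); last by ring.
  rewrite ler_wpM2l//.
  apply: (@le_trans _ _ (\sum_(t < s.+1) Mpow (- p) s * Mpow p t * (B * K))).
    apply: ler_sum => t _; rewrite ler_wpM2l ?mulr_ge0 ?Mpow_ge0//.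
    rewrite (le_trans (qK _ _ (leqnn s)))// mulfK//.
    by rewrite pnatr_eq0 -lt0n Mprod_gt0.
  rewrite -mulr_suml -mulr_sumr mulrC ler_wpM2l ?mulr_ge0//.
  by rewrite MpowN mulrC ler_pdivrMr ?Mpow_gt0// sum_Mpow_le.
Qed.

End weighted_sums.

(** * Lower bound for the weight *)

Section weight_bounds.
Variables (R : realType) (m : nat -> nat) (p : R) (B : nat).
Hypothesis m_ge2 : forall k, (2 <= m k)%N.
Hypothesis m_le : forall k, (m k <= B)%N.
Hypothesis p_gt0 : 0 < p.
Hypothesis p_le : p <= 2^-1.
Local Notation M := (Mprod m).

Lemma bound_gt0 : 0 < B%:R :> R.
Proof. by rewrite ltr0n (leq_trans _ (m_le 0))// ltnW// m_ge2. Qed.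

Lemma ln_gt0_nat n : (0 < n)%N -> 0 < ln n.+1%:R :> R.
Proof. by move=> n0; rewrite ln_gt0// ltr1n ltnS. Qed.

(** The logarithm is thus present in the weight only at the endpoint [p = 1/2]. *)
Lemma floor_half : Num.floor (2^-1 + p) = (p == 2^-1)%:R.
Proof.
apply: floor_def; case: eqP => [->|/eqP pE] /=.
  by apply/andP; split; lra.
have {pE} : p < 2^-1 by rewrite lt_neqAle pE.
by move: p_gt0 => *; apply/andP; split; lra.
Qed.

Lemma exponent_ge0 : 0 <= p^-1 - 2.
Proof.
by rewrite subr_ge0 -[2]invrK lef_pV2 ?posrE ?invr_gt0.
Qed.

Lemma weightE n : weight p n = n.+1%:R `^ (p^-1 - 2) *
  (if p == 2^-1 then ln n.+1%:R ^+ 2 else 1).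
Proof. by rewrite /weight floor_half; case: eqP => _; rewrite ?mulr0// expr0z. Qed.

Lemma weight_gt0 n : (0 < n)%N -> 0 < weight p n.
Proof.
move=> n0; rewrite weightE mulr_gt0// ?powR_gt0//.
by case: ifP => // _; rewrite exprn_gt0// ln_gt0_nat.
Qed.

Lemma weight_le j n : (0 < j)%N -> (j <= n)%N -> weight p j <= weight p n.
Proof.
move=> j0 jn; rewrite !weightE ler_pM ?powR_ge0//.
- by case: ifP => // _; rewrite exprn_ge0// ltW// ln_gt0_nat.
- by rewrite ge0_ler_powR ?nnegrE// ?exponent_ge0// ler_nat ltnS.
- case: ifP => // _; rewrite lerXn2r ?nnegrE ?(ltW (ln_gt0_nat _))//.
    exact: leq_trans jn.
  by rewrite ler_ln ?posrE// ler_nat ltnS.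
Qed.

(** Since [2 ^ A <= M A], comparison with a geometric series of ratio below 1. *)
Lemma log_factor_lt_half : p < 2^-1 -> forall N,
  log_factor m p N <= (1 - 2 `^ (2 * p - 1))^-1.
Proof.
move=> p_lt N; have r0 : 0 < 1 - 2 * p by lra.
set r := 1 - 2 * p in r0.
have -> : 2 * p - 1 = - r by rewrite /r; ring.
rewrite -/(geom_const r) /log_factor.
apply: (@le_trans _ _ (\sum_(A < N.+1) (2 `^ (- r)) ^+ A)).
  rewrite ler_sum// => A _; rewrite (_ : 2 * p - 1 = - r); last by rewrite /r; ring.
  rewrite -powR_mulrn ?powR_ge0// -powRrM mulrC powRrM powR_mulrn// MpowN powRN.
  rewrite lef_pV2 ?posrE ?Mpow_gt0 ?powR_gt0 ?exprn_gt0//.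
  rewrite ge0_ler_powR ?nnegrE ?(ltW r0) ?exprn_ge0//.
  by rewrite -natrX ler_nat leq_exp2_Mprod.
elim: N => [|N ih]; first by rewrite big_ord1 expr0 geom_const_ge1.
rewrite big_ord_recl expr0; under eq_bigr do rewrite lift0 exprSr.
rewrite -mulr_suml addrC -[leRHS](geom_constE r0) lerD2r ler_wpM2r ?powR_ge0//.
Qed.

Lemma log_factor_half N : p = 2^-1 -> log_factor m p N = N.+1%:R.
Proof.
move=> ->; rewrite /log_factor (eq_bigr (fun=> 1)).
  by rewrite sumr_const card_ord.
by move=> A _; rewrite /Mpow divff// subrr powRr0.
Qed.

(** The powers of [n] and [n + 1] multiply to at least [n ^ (1 - p)], and [M N.+1 <= B * n]. At
    [p = 1/2] the [p]-th power of the squared logarithm is the logarithm, comparable to [N]. *)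
Lemma weight_lower : exists2 k : R, 0 < k & forall n N,
  (0 < n)%N -> (M N <= n)%N -> (n < M N.+1)%N ->
  k * (Mpow m (1 - p) N.+1 * log_factor m p N.+1) <= (n%:R * weight p n) `^ p.
Proof.
(* [k0] handles the logarithmic factor; the power [p - 1] of [B] chosen below comes from
   [M N.+1 <= B * n]. *)
pose k0 : R := if p == 2^-1 then ln 2 / 3 else 1 - 2 `^ (2 * p - 1).
have ln2 : 0 < ln 2 :> R by rewrite ln_gt0// ltr1n.
have k00 : 0 < k0.
  rewrite /k0; case: eqP => [_|/eqP pE]; first by rewrite divr_gt0.
  have p_lt : p < 2^-1 by rewrite lt_neqAle pE.
  have r0 : 0 < 1 - 2 * p by lra.
  rewrite (_ : 2 * p - 1 = - (1 - 2 * p)); last by ring.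
  by rewrite subr_gt0 powR2N_lt1.
exists (B%:R `^ (p - 1) * k0); first by rewrite mulr_gt0// powR_gt0// bound_gt0.
move=> n N n0 Nn nN.
have n0R : 0 < n%:R :> R by rewrite ltr0n.
rewrite mulrACA powRM//; last exact/ltW/weight_gt0.
have logE : k0 * log_factor m p N.+1 <=
    (if p == 2^-1 then ln n.+1%:R ^+ 2 else 1) `^ p.
  rewrite /k0; case: eqP => [pE|/eqP pE].
    rewrite log_factor_half// pE powR12_sqrt ?sqr_ge0// sqrtr_sqr.
    rewrite ger0_norm ?(ltW (ln_gt0_nat n0))//.
    (* Here [log_factor] equals [N + 2]: the part [N] is paid by [2 ^ N <= n], the part 2 by
       [n >= 1], which explains the 3 in [k0]. *)
    have h1 : ln 2 <= ln n.+1%:R :> R by rewrite ler_ln ?posrE// ler_nat ltnS.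
    have h2 : N%:R * ln 2 <= ln n.+1%:R :> R.
      rewrite mulr_natl -lnXn// ler_ln ?posrE ?exprn_gt0// -natrX ler_nat.
      by rewrite (leq_trans (leq_exp2_Mprod m_ge2 N))// (leq_trans Nn).
    have -> : N.+2%:R = N%:R + 2 :> R by rewrite -natrD addn2.
    by lra.
  have p_lt : p < 2^-1 by rewrite lt_neqAle pE.
  rewrite powR1 (le_trans (ler_wpM2l _ (log_factor_lt_half p_lt _)))//.
    by move: k00; rewrite /k0 (negbTE pE) => /ltW.
  by rewrite divff//; move: k00; rewrite /k0 (negbTE pE) => /lt0r_neq0.
rewrite weightE powRM ?powR_ge0//; last first.
  by case: ifP => // _; rewrite sqr_ge0.
rewrite [leRHS]mulrA ler_pM// ?mulr_ge0 ?powR_ge0 ?(ltW k00)//.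
  exact/ltW/log_factor_gt0.
rewrite -powRrM mulrBl mulVf ?gt_eqF//.
rewrite (@le_trans _ _ (n%:R `^ p * n%:R `^ (1 - 2 * p)))//; last first.
  rewrite ler_wpM2l ?powR_ge0// ge0_ler_powR ?nnegrE// ?ler_nat//.
  by have := p_le; lra.
rewrite -powRD; last by apply/implyP => _; rewrite gt_eqF.
rewrite (_ : p + (1 - 2 * p) = 1 - p); last by ring.
rewrite (_ : p - 1 = - (1 - p)); last by ring.
rewrite powRN mulrC ler_pdivrMr ?powR_gt0 ?bound_gt0// -powRM ?(ltW bound_gt0)//.
rewrite ge0_ler_powR ?nnegrE ?mulr_ge0//; last 1 first.
- rewrite -natrM ler_nat MprodS (leq_trans _ (leq_mul Nn (m_le N)))//.
- by have := p_le; lra.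
Qed.

End weight_bounds.

(** * Summation by parts with non-increasing coefficients *)

Lemma sum_by_parts (V : pzRingType) (q z : nat -> V) n :
  \sum_(k < n) q k * z k =
  q n * (\sum_(k < n) z k) + \sum_(j < n) (q j - q j.+1) * \sum_(k < j.+1) z k.
Proof.
elim: n => [|n ih]; first by rewrite !big_ord0 mulr0 addr0.
rewrite big_ord_recr/= ih.
rewrite [\sum_(j < n.+1) (q j - q j.+1) * _]big_ord_recr/= addrCA -mulrDl.
rewrite subrKC [\sum_(k < n.+1) z k]big_ord_recr/= mulrDr.
by rewrite addrAC addrC.
Qed.

(** After summation by parts all coefficients are nonnegative. The same identity applied to the
    constant 1 shows that the bounds add up to the sum of [q]. *)
Lemma normc_weighted_sum_le (R : realType) (q : nat -> R) (z : nat -> R[i]) n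
    (S : R) :
  (forall k, 0 <= q k) -> (forall k, q k.+1 <= q k) ->
  (forall j, (j <= n)%N -> Normc.normc (\sum_(k < j) z k) <= j%:R * S) ->
  Normc.normc (\sum_(k < n) (q k)%:C%C * z k) <= (\sum_(k < n) q k) * S.
Proof.
move=> q0 qd zS.
have normcZ (a : R) (w : R[i]) : 0 <= a ->
    Normc.normc (a%:C%C * w) = a * Normc.normc w.
  move=> a0; rewrite Normc.normcM; congr (_ * _).
  by rewrite /= expr0n addr0 sqrtr_sqr ger0_norm.
have -> : \sum_(k < n) q k = q n * n%:R + \sum_(j < n) (q j - q j.+1) * j.+1%:R.
  have := @sum_by_parts R q (fun=> 1) n.
  under eq_bigr do rewrite mulr1.
  move=> ->; rewrite sumr_const card_ord; congr (_ + _).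
  by apply: eq_bigr => j _; rewrite sumr_const card_ord.
rewrite (sum_by_parts (fun k => (q k)%:C%C)) mulrDl.
apply: le_trans (le_normcD _ _) _; rewrite lerD//.
  by rewrite normcZ// -mulrA ler_wpM2l// zS.
rewrite (le_trans (normc_sum _ _))// mulr_suml ler_sum// => j _.
by rewrite -rmorphB normcZ ?subr_ge0// -mulrA ler_wpM2l ?subr_ge0// zS.
Qed.

(* Holds without measurability because the integral of a nonnegative function is
   a supremum over the simple functions below it. *)
Lemma ge0_le_integral_nonmeasurable d (T : measurableType d) (R : realType)
    (mu : {measure set T -> \bar R}) (g h : T -> \bar R) :
  (forall x, 0 <= g x)%E -> (forall x, g x <= h x)%E ->
  (\int[mu]_x g x <= \int[mu]_x h x)%E.
Proof.
move=> g0 gh; rewrite !ge0_integralTE//; last by move=> x; exact: le_trans (gh x).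
apply: le_ereal_sup => _ [k /= kg <-]; exists k => // x.
exact: le_trans (gh x).
Qed.

(** * The maximal operator *)

Section pointwise_bound.
Variables (R : realType) (m : nat -> nat) (p : R) (B : nat).
Hypothesis m_ge2 : forall k, (2 <= m k)%N.
Hypothesis m_le : forall k, (m k <= B)%N.
Hypothesis p_gt0 : 0 < p.
Hypothesis p_le : p <= 2^-1.
Variable mu : probability (vilenkin m) R.
Hypothesis mu_haar : is_haar mu.
Variable f : nat -> vilenkin m -> R[i].
Hypothesis f_martingale : martingale mu f.
Local Notation G := (vilenkin m).
Local Notation M := (Mprod m).

Definition modulus (x : G) (s : nat) : R := Normc.normc (f s x).

(** The function called u_s in the opening description. *)
Definition jump s (x : G) : R := new_record (modulus x) s.

Definition level_majorant s (x : G) : R :=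
  level_sum m p s (fun A t => nearby_sum s A t (fun y => jump s y `^ p) x).

Lemma modulus_ge0 x s : 0 <= modulus x s.
Proof. exact: normc_ge0. Qed.

Lemma jump_ge0 s x : 0 <= jump s x.
Proof. by apply: new_record_ge0 => k; exact: modulus_ge0. Qed.

Lemma jump_depends s : depends_on s (jump s).
Proof.
move=> x y xy; apply: eq_new_record => k ks.
by rewrite /modulus (martingale_depends_on f_martingale (cylinder_le ks xy)).
Qed.

Lemma jump_pow_depends s : depends_on s (fun x => jump s x `^ p).
Proof. exact: (depends_on_comp (fun r => r `^ p) (@jump_depends s)). Qed.

Lemma level_majorant_ge0 s x : 0 <= level_majorant s x.
Proof.
apply: level_sum_ge0 => // A t; apply: nearby_sum_ge0 => y; exact: powR_ge0.
Qed.

Lemma level_majorant_depends s : depends_on s (level_majorant s).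
Proof.
move=> x y xy; have E A t : (A <= s)%N ->
    nearby_sum s A t (fun y => jump s y `^ p) y =
    nearby_sum s A t (fun y => jump s y `^ p) x.
  by move=> As; exact: (nearby_sum_depends _ _ As xy).
rewrite /level_majorant /level_sum; congr (_ * _ + _ * _).
  apply: eq_bigr => A _; apply: eq_bigr => t _; rewrite E//.
  by rewrite -ltnS.
by apply: eq_bigr => t _; rewrite E.
Qed.

Lemma sum_level_sum (I : finType) s (q : I -> nat -> nat -> R) :
  \sum_i level_sum m p s (q i) = level_sum m p s (fun A t => \sum_i q i A t).
Proof.
rewrite /level_sum big_split/= -!mulr_sumr; congr (_ * _ + _ * _).
  rewrite exchange_big; apply: eq_bigr => A _ /=.
  rewrite exchange_big; apply: eq_bigr => t _ /=.
  by rewrite mulr_sumr.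
by rewrite exchange_big; apply: eq_bigr => t _ /=; rewrite mulr_sumr.
Qed.

(** [level_sum] is linear in its last argument, so the sum over cells moves inside, where
    [sum_nearby_sum] supplies the hypothesis of [sum_level_const]. *)
Lemma integral_level_majorant s :
  (\int[mu]_x (level_majorant s x)%:E <=
   (B%:R * (geom_const p + geom_const p ^+ 2))%:E *
   \int[mu]_x (jump s x `^ p)%:E)%E.
Proof.
rewrite (integral_cells mu measurableT (@level_majorant_depends s)).
rewrite (integral_cells mu measurableT (@jump_pow_depends s)).
have cells (g : G -> R) :
    \sum_(c : cell m s) g (rep c) * fine (mu (setT `&` cylinder s (rep c))) =
    (M s)%:R^-1 * \sum_(c : cell m s) g (rep c).
  by rewrite mulr_sumr; apply: eq_bigr => c _; rewrite setTI mu_cylinder//= mulrC.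
rewrite (cells (level_majorant s)) (cells (fun x => jump s x `^ p)) -EFinM lee_fin mulrCA ler_wpM2l ?invr_ge0//.
rewrite sum_level_sum sum_level_const//.
  by rewrite sumr_ge0// => c _; exact: powR_ge0.
move=> A t As; apply: (sum_nearby_sum m_ge2 m_le mu_haar) => // y.
exact: powR_ge0.
Qed.

Lemma maximal_ge0 x : (0 <= maximal f x)%E.
Proof.
apply: (@le_trans _ _ (modulus x 0)%:E); first by rewrite lee_fin modulus_ge0.
by apply: ereal_sup_ubound; exists 0%N.
Qed.

Lemma sum_jump_pow_le n x :
  (\sum_(s < n) (jump s x `^ p)%:E <=
   (geom_const p)%:E * maximal f x `^ p)%E.
Proof.
have max0 := maximal_ge0 x.
have C0 := ltW (geom_const_gt0 p_gt0).
case: n => [|n]; first by rewrite big_ord0 mule_ge0 ?lee_fin ?poweR_ge0.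
rewrite sumEFin; apply: (@le_trans _ _ (geom_const p * last_record (modulus x) n `^ p)%:E).
  rewrite lee_fin; apply: sum_new_record_le => // s; exact: modulus_ge0.
rewrite EFinM lee_wpmul2l ?lee_fin// -poweR_EFin gt0_ler_poweR ?(ltW p_gt0)//.
- by rewrite in_itv/= leey andbT lee_fin last_record_ge0// => s; exact: modulus_ge0.
- by rewrite in_itv/= leey andbT.
have [k _ ->] := last_record_ex (modulus x) n.
by apply: ereal_sup_ubound; exists k.
Qed.

Variable k : R.
Hypothesis k_gt0 : 0 < k.
Hypothesis weight_ge : forall n N, (0 < n)%N -> (M N <= n)%N -> (n < M N.+1)%N ->
  k * (Mpow m (1 - p) N.+1 * log_factor m p N.+1) <= (n%:R * weight p n) `^ p.

(** The 2 comes from the records, [B ^ 2] from the kernel bound and one more [B] from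
    [nearby_sum_coarsen]. *)
Let K0 : R := 2 * B%:R ^+ 3.
Let K : R := K0 `^ p / k.

Lemma powR_sum_le_half (I : Type) (r : seq I) (a : I -> R) : (forall i, 0 <= a i) ->
  (\sum_(i <- r) a i) `^ p <= \sum_(i <- r) a i `^ p.
Proof. by move=> a0; apply: powR_sum_le => //; have := p_le; lra. Qed.

Lemma nearby_sum_pow_le s A t (v : G -> R) x : (forall y, 0 <= v y) ->
  nearby_sum s A t v x `^ p <= nearby_sum s A t (fun y => v y `^ p) x.
Proof.
move=> v0; apply: le_trans (powR_sum_le_half _ _) _ => [c|].
  by rewrite mulr_ge0.
apply: ler_sum => c _; case: (nearby _ _ _ _); first by rewrite !mul1r.
by rewrite !mul0r powR0// gt_eqF.
Qed.

Lemma normc_fejer_sum_le n N x : (n < M N)%N ->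
  Normc.normc (\sum_(k < n) partial_sum mu f k x) <=
  \sum_(A < N) \sum_(t < A.+1) \sum_(s < N.+1)
    K0 * (M A)%:R * (M t)%:R * ((M (maxn A s))%:R^-1 *
      nearby_sum s (minn A s) (minn t s) (jump s) x).
Proof.
move=> nN.
apply: le_trans (normc_sum_partial_sum m_ge2 mu_haar f_martingale m_le x nN) _.
rewrite mulr_sumr ler_sum// => A _; rewrite mulr_sumr ler_sum// => t _.
apply: (@le_trans _ _ (B%:R ^+ 2 * ((M A)%:R * (M t)%:R *
    (2 * \sum_(s < N.+1) (M N)%:R^-1 * nearby_sum N A t (jump s) x)))).
  rewrite ler_wpM2l ?exprn_ge0// ler_wpM2l ?mulr_ge0// -mulr_sumr mulrCA.
  rewrite ler_wpM2l ?invr_ge0// /nearby_sum exchange_big mulr_sumr ler_sum// => c _.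
  rewrite -mulr_sumr mulrCA ler_wpM2l//.
  exact: (le_sum_new_record (modulus_ge0 _)).
rewrite mulrA mulrCA !mulr_sumr ler_sum// => s _.
have sN : (s <= N)%N by rewrite -ltnS.
have := nearby_sum_coarsen m_ge2 m_le mu_haar t x sN (ltnW (ltn_ord A))
  (@jump_depends s) (jump_ge0 s).
move=> /(ler_wpM2l (_ : 0 <= 2 * (B%:R ^+ 2 * ((M A)%:R * (M t)%:R)))) h.
rewrite mulrA (le_trans (h _))// ?mulr_ge0//.
by rewrite le_eqVlt; apply/orP; left; apply/eqP; rewrite /K0; ring.
Qed.

(** Subadditivity is applied to all four sums, over [A], [t], [s] and the cells; [scale_sum_le] then
    treats each [s] separately. *)
Lemma fejer_sum_pow_le n N x : (n < M N)%N ->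
  Normc.normc (\sum_(k < n) partial_sum mu f k x) `^ p <=
  K0 `^ p * (Mpow m (1 - p) N * log_factor m p N *
    \sum_(s < N.+1) level_majorant s x).
Proof.
move=> nN; have K00 : 0 <= K0 by rewrite mulr_ge0 ?exprn_ge0.
have n0 s A t : 0 <= nearby_sum s A t (jump s) x.
  by apply: nearby_sum_ge0; exact: jump_ge0.
have t0 (A t s : nat) : 0 <= K0 * (M A)%:R * (M t)%:R * ((M (maxn A s))%:R^-1 *
      nearby_sum s (minn A s) (minn t s) (jump s) x).
  by rewrite !mulr_ge0 ?invr_ge0.
apply: (@le_trans _ _ (\sum_(A < N) \sum_(t < A.+1) \sum_(s < N.+1)
  K0 `^ p * (Mpow m p A * Mpow m p t * Mpow m (- p) (maxn A s) *
    nearby_sum s (minn A s) (minn t s) (fun y => jump s y `^ p) x))).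
  apply: (le_trans (ge0_ler_powR _ _ _ (normc_fejer_sum_le x nN))).
  - exact: ltW.
  - by rewrite nnegrE normc_ge0.
  - by rewrite nnegrE; do 3 (apply: sumr_ge0 => ? _).
  apply: le_trans (powR_sum_le_half _ _) _ => [A|].
    by do 2 (apply: sumr_ge0 => ? _).
  apply: ler_sum => A _; apply: le_trans (powR_sum_le_half _ _) _ => [t|].
    by apply: sumr_ge0 => ? _.
  apply: ler_sum => t _; apply: le_trans (powR_sum_le_half _ _) _ => [s|]; first exact: t0.
  apply: ler_sum => s _; rewrite !powRM ?mulr_ge0 ?invr_ge0//.
  rewrite /Mpow -!mulrA.
  rewrite -[_^-1]powR_inv1// -powRrM mulN1r.
  do 7 (apply: ler_wpM2l; first exact: powR_ge0).
  by apply: nearby_sum_pow_le; exact: jump_ge0.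
under eq_bigr => A _ do rewrite exchange_big.
rewrite exchange_big/= mulrA mulr_sumr ler_sum// => s _.
under eq_bigr do rewrite -mulr_sumr.
rewrite -mulr_sumr -mulrA ler_wpM2l ?powR_ge0//.
have L0 := log_factor_gt0 p m_ge2 N.
have M0 : 0 < Mpow m (1 - p) N := Mpow_gt0 m_ge2 _ _.
rewrite -ler_pdivrMl ?mulr_gt0//.
have := @scale_sum_le _ _ _ m_ge2 p_gt0 p_le s N
  (fun A t => nearby_sum s A t (fun y => jump s y `^ p) x).
rewrite -ltnS ltn_ord => /(_ _ isT); rewrite -opprB MpowN -invfM; apply.
by move=> A t; apply: nearby_sum_ge0 => y; exact: powR_ge0.
Qed.

Lemma pointwise_const_ge0 : 0 <= K.
Proof. by rewrite divr_ge0 ?powR_ge0// ltW. Qed.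

Variable q : nat -> R.
Hypothesis q_ge0 : forall i, 0 <= q i.
Hypothesis q0_gt0 : 0 < q 0%N.
Hypothesis q_nincr : forall i, q i.+1 <= q i.

Lemma T_mean_pow_le n x : (0 < n)%N ->
  (Normc.normc (T_mean mu q f n x) / weight p n) `^ p <=
  K * \sum_(s < n.+1) level_majorant s x.
Proof.
move=> n0; have K0' := pointwise_const_ge0.
set Y := \sum_(s < n.+1) _.
have Y0 : 0 <= Y by apply: sumr_ge0 => s _; exact: level_majorant_ge0.
have E0 : 0 <= K * Y by rewrite mulr_ge0.
have wn0 : 0 < weight p n by exact: weight_gt0.
(* Summation by parts needs a bound on the means themselves, so the bound on their [p]-th powers is
   turned into one by [E]. *)
pose E := (K * Y) `^ p^-1.
have Ep : E `^ p = K * Y by rewrite -powRrM mulVf ?gt_eqF// powRr1.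
have fejer_le j : (j <= n)%N ->
    Normc.normc (\sum_(i < j) partial_sum mu f i x) <= j%:R * (weight p n * E).
  case: j => [|j] jn; first by rewrite big_ord0 Normc.normc0 mul0r.
  have [N Nj jN] := Mprod_interval m_ge2 (ltn0Sn j).
  have wj0 : 0 < weight p j.+1 by exact: weight_gt0.
  apply: (@le_trans _ _ (j.+1%:R * weight p j.+1 * E)); last first.
    by rewrite mulrA ler_wpM2r ?powR_ge0// ler_wpM2l// weight_le.
  have jw0 : 0 <= j.+1%:R * weight p j.+1 by rewrite mulr_ge0// ltW.
  rewrite leNgt; apply/negP => lt.
  have := gt0_ltr_powR p_gt0 _ _ lt; rewrite !nnegrE normc_ge0 mulr_ge0 ?powR_ge0//.
  move=> /(_ isT isT); apply/negP; rewrite -leNgt powRM ?powR_ge0// Ep.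
  apply: (le_trans (fejer_sum_pow_le x jN)).
  (* From [N < M N <= j.+1 <= n]: the levels used for [j.+1] all occur in [Y]. *)
  have Nn : (N.+2 <= n.+1)%N.
    by rewrite ltnS (leq_trans _ jn)// (leq_trans _ Nj)// ltn_Mprod.
  have SY : \sum_(s < N.+2) level_majorant s x <= Y.
    rewrite /Y -(subnKC Nn) big_split_ord/= lerDl sumr_ge0// => s _.
    exact: level_majorant_ge0.
  have ML : Mpow m (1 - p) N.+1 * log_factor m p N.+1 <=
      (j.+1%:R * weight p j.+1) `^ p / k.
    by rewrite ler_pdivlMr// mulrC weight_ge.
  rewrite /K (_ : _ * (_ / k * Y) =
    K0 `^ p * ((j.+1%:R * weight p j.+1) `^ p / k * Y)); last by ring.
  rewrite ler_wpM2l ?powR_ge0// ler_pM//.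
  - by rewrite mulr_ge0 ?Mpow_ge0// ltW// log_factor_gt0.
  - by apply: sumr_ge0 => s _; exact: level_majorant_ge0.
have Q0 : 0 < \sum_(i < n) q i.
  case: n n0 {Y Y0 E0 wn0 E Ep fejer_le} => // n _.
  by rewrite big_ord_recl ltr_wpDr// sumr_ge0.
have T_le : Normc.normc (T_mean mu q f n x) <= weight p n * E.
  rewrite /T_mean Normc.normcM.
  have -> : Normc.normc ((\sum_(i < n) q i)^-1%:C%C) = (\sum_(i < n) q i)^-1.
    by rewrite /= expr0n addr0 sqrtr_sqr ger0_norm// invr_ge0 ltW.
  rewrite ler_pdivrMl//.
  exact: (@normc_weighted_sum_le R q (fun i => partial_sum mu f i x)).
rewrite -Ep ge0_ler_powR ?nnegrE ?(ltW p_gt0) ?powR_ge0//.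
  by rewrite divr_ge0 ?normc_ge0// ltW.
by rewrite ler_pdivrMr// mulrC.
Qed.

Lemma maximal_T_ge0 x : (0 <= maximal_T mu p q f x)%E.
Proof.
apply: (@le_trans _ _ (Normc.normc (T_mean mu q f 1 x) / weight p 1)%:E).
  by rewrite lee_fin divr_ge0 ?normc_ge0// ltW// weight_gt0.
by apply: ereal_sup_ubound; exists 1%N.
Qed.

(** Passing to the whole series removes the last dependence on [n]; taking [p]-th roots allows the
    supremum to be bounded term by term. *)
Lemma maximal_T_pow_le x : (maximal_T mu p q f x `^ p <=
  K%:E * \sum_(s <oo) (level_majorant s x)%:E)%E.
Proof.
have K0' := pointwise_const_ge0.
set b := (K%:E * _)%E.
have S0 : (0 <= \sum_(s <oo) (level_majorant s x)%:E)%E.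
  by apply: nneseries_ge0 => s _ _; rewrite lee_fin level_majorant_ge0.
have b0 : (0 <= b)%E by rewrite mule_ge0 ?lee_fin.
have p0 : p != 0 by rewrite gt_eqF.
have bE : ((b `^ p^-1) `^ p = b)%E by rewrite -poweRrM mulVf// poweRe1.
have T0 := maximal_T_ge0 x.
rewrite -bE gt0_ler_poweR ?in_itv/= ?leey ?andbT ?poweR_ge0 ?(ltW p_gt0)//.
apply: ge_ereal_sup => _ [n /= n0 <-].
set r := _ / _; have r0 : 0 <= r by rewrite divr_ge0 ?normc_ge0// ltW// weight_gt0.
have -> : r%:E = ((r%:E `^ p) `^ p^-1)%E by rewrite -poweRrM mulfV// poweRe1.
rewrite gt0_ler_poweR ?in_itv/= ?leey ?andbT ?lee_fin ?powR_ge0 ?invr_ge0 ?(ltW p_gt0)//.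
rewrite (le_trans (_ : _ <= (K * \sum_(s < n.+1) level_majorant s x)%:E)%E)//.
  by rewrite lee_fin T_mean_pow_le.
rewrite EFinM lee_wpmul2l ?lee_fin// -sumEFin -(big_mkord xpredT (fun s => (level_majorant s x)%:E)).
apply: nneseries_lim_ge => s _ _; by rewrite lee_fin level_majorant_ge0.
Qed.

Lemma measurable_maximal : measurable_fun setT (maximal f).
Proof.
rewrite (_ : maximal f = fun x => esups (fun n => (modulus x n)%:E) 0).
  apply: (measurable_fun_esups (f := fun n x => (modulus x n)%:E)) => n.
  apply/measurable_EFinP.
  apply: (@depends_on_measurable _ _ n) => x y xy.
  by rewrite /modulus (martingale_depends_on f_martingale xy).
apply/funext => x; congr ereal_sup; apply/seteqP.
by split=> _ [n _ <-]; exists n.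
Qed.

(** The majorants are integrated term by term and each is compared with its [jump]; for every finite
    number of levels the jumps are summed again under the integral, where [sum_jump_pow_le]
    applies. *)
Lemma integral_maximal_T_pow_le :
  (\int[mu]_x (maximal_T mu p q f x `^ p) <=
   (K * (B%:R * (geom_const p + geom_const p ^+ 2)) * geom_const p)%:E *
   \int[mu]_x (maximal f x `^ p))%E.
Proof.
have K0' := pointwise_const_ge0.
have C0 := ltW (geom_const_gt0 p_gt0).
set D := B%:R * _; have D0 : 0 <= D by rewrite mulr_ge0// addr_ge0 ?exprn_ge0.
have Y0 s x : (0 <= (level_majorant s x)%:E)%E by rewrite lee_fin level_majorant_ge0.
have mY s : measurable_fun setT (fun x => (level_majorant s x)%:E).
  apply/measurable_EFinP; exact: (depends_on_measurable (@level_majorant_depends s)).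
have mJ s : measurable_fun setT (fun x => (jump s x `^ p)%:E).
  apply/measurable_EFinP; exact: (depends_on_measurable (@jump_pow_depends s)).
have J0 s x : (0 <= (jump s x `^ p)%:E)%E by rewrite lee_fin powR_ge0.
apply: (@le_trans _ _ (\int[mu]_x (K%:E * \sum_(s <oo) (level_majorant s x)%:E))%E).
  by apply: ge0_le_integral_nonmeasurable => x; [exact: poweR_ge0|exact: maximal_T_pow_le].
rewrite ge0_integralZl_EFin//; last 2 first.
- by move=> x _; exact: nneseries_ge0.
- by apply: ge0_emeasurable_sum.
rewrite integral_nneseries//.
have -> : (K * D * geom_const p)%:E = (K%:E * (D%:E * (geom_const p)%:E))%E.
  by rewrite -!EFinM mulrA.
rewrite -[leRHS]muleA lee_wpmul2l ?lee_fin//.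
apply: lime_le; first by apply: is_cvg_nneseries => s _ _; exact: integral_ge0.
apply: nearW => n; rewrite /= big_mkord.
apply: (@le_trans _ _ (\sum_(s < n) D%:E * \int[mu]_x (jump s x `^ p)%:E)%E).
  by apply: lee_sum => s _; exact: integral_level_majorant.
rewrite -ge0_sume_distrr; last by move=> s _; exact: integral_ge0.
rewrite -[leRHS]muleA lee_wpmul2l ?lee_fin//.
rewrite -ge0_integral_sum//.
apply: (@le_trans _ _ (\int[mu]_x ((geom_const p)%:E * maximal f x `^ p))%E).
  apply: ge0_le_integral_nonmeasurable => x; first exact: sume_ge0.
  exact: sum_jump_pow_le.
rewrite ge0_integralZl_EFin//; first by move=> x _; exact: poweR_ge0.
apply: (measurableT_comp (measurable_poweR p)); exact: measurable_maximal.
Qed.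

End pointwise_bound.

Theorem theorem1 (R : realType) (m : nat -> nat)
    (m_ge2 : forall k, (2 <= m k)%N)
    (m_bounded : exists B : nat, forall k, (m k <= B)%N)
    (mu : probability (vilenkin m) R) (mu_haar : is_haar mu)
    (p : R) (p_gt0 : 0 < p) (p_le : p <= 2^-1) :
  exists c : R,
    forall q : nat -> R,
      (forall k, 0 <= q k) -> 0 < q 0%N -> (forall k, q k.+1 <= q k) ->
    forall f : nat -> vilenkin m -> R[i],
      hardy mu p f ->
      (Lnorm mu p%:E (maximal_T mu p q f) <= c%:E * hardy_norm mu p f)%E.
Proof.
have [B m_le] := m_bounded.
have [k k0 weight_ge] := weight_lower m_ge2 m_le p_gt0 p_le.
pose K := (2 * B%:R ^+ 3) `^ p / k * (B%:R * (geom_const p + geom_const p ^+ 2)) *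
  geom_const p.
have C0 := ltW (geom_const_gt0 p_gt0).
have K0 : 0 <= K.
  rewrite mulr_ge0// mulr_ge0//; first by rewrite divr_ge0 ?powR_ge0// ltW.
  by rewrite mulr_ge0// addr_ge0 ?exprn_ge0.
(* The constant is fixed before [q] and [f]. Both sides are [p]-th roots of integrals, so it remains
   to compare the integrals with constant [K]. *)
exists (K `^ p^-1) => q q_ge0 q0_gt0 q_nincr f [f_martingale _].
rewrite /hardy_norm unlock -poweR_EFin -poweRM ?lee_fin//; last first.
  by apply: integral_ge0 => x _; exact: poweR_ge0.
have p1 : 0 <= p^-1 by rewrite invr_ge0 ltW.
rewrite gt0_ler_poweR// ?in_itv/= ?leey ?andbT.
- by apply: integral_ge0 => x _; exact: poweR_ge0.
- by rewrite mule_ge0 ?lee_fin// integral_ge0// => x _; exact: poweR_ge0.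
under eq_integral => x _ do rewrite gee0_abs ?(maximal_T_ge0 p_gt0)//.
under [X in (_ <= _ * X)%E]eq_integral => x _ do rewrite gee0_abs ?maximal_ge0//.
exact: (integral_maximal_T_pow_le m_ge2 m_le p_gt0 p_le mu_haar f_martingale k0
  weight_ge q_ge0 q0_gt0 q_nincr).
Qed.
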